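(* Let $0<\alpha<1$ and let $k\geq 1$ be an integer. Let $R_{k-1,k}$ denote the $(k-1,k)$-Padé approximant of the function $x\mapsto x^{-\alpha}$ centered at $x=1$, and define the truncation error $$E_{k-1,k}(1-z):=(1-z)^{-\alpha}-R_{k-1,k}(1-z).$$ Then, for real $z<1$, $z\neq 0$, $$E_{k-1,k}(1-z)=\frac{\Gamma(k+1-\alpha)\,\Gamma(k+1)}{\Gamma(1-\alpha)\,\Gamma(2k+1)}\;\frac{{}_2F_1(k+1,k+\alpha;2k+1;z)}{{}_2F_1(-k,k;\alpha;z^{-1})}\,(-z)^{k},$$ where $\Gamma$ is the gamma function and ${}_2F_1$ is the Gauss hypergeometric function (analytically continued where needed; note ${}_2F_1(-k,k;\alpha;z^{-1})$ is a polynomial in $z^{-1}$).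
   Context: The $(k-1,k)$-Padé approximant $R_{k-1,k}=p_{k-1}/q_k$ (with $p_{k-1}$ of degree at most $k-1$ and $q_k$ of degree at most $k$) of $x^{-\alpha}$ at $x=1$ is the rational function whose Taylor expansion at $x=1$ agrees with that of $x^{-\alpha}$ to the highest possible order. Equivalently (a known fact), for any $\tau>0$, $\tau^{-\alpha}R_{k-1,k}(\lambda/\tau)=\sum_{j=1}^k \gamma_j(\eta_j+\lambda)^{-1}$, where $\gamma_j=\frac{2\sin(\alpha\pi)\tau^{1-\alpha}}{\pi}\frac{w_j}{1+\vartheta_j}$, $\eta_j=\frac{\tau(1-\vartheta_j)}{1+\vartheta_j}$, and $w_j,\vartheta_j$ are the weights and nodes of the $k$-point Gauss–Jacobi quadrature rule on $[-1,1]$ for the weight $(1-t)^{-\alpha}(1+t)^{\alpha-1}$. *)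

(* Defs.v *)
From Stdlib Require Import Reals Lra Lia Arith ClassicalEpsilon.
Open Scope R_scope.

Fixpoint poch (a : R) (n : nat) : R :=
  match n with
  | O => 1
  | S m => poch a m * (a + INR m)
  end.

(* Gamma function, via Gauss' (Euler's) limit formula
   Gamma x = lim_{n->oo} n! n^x / (x (x+1) ... (x+n)).
   (Stdlib has no Gamma function.)  Value is the limit when it exists. *)
Definition gauss_seq (x : R) (n : nat) : R :=
  INR (fact n) * Rpower (INR n) x / poch x (S n).

Definition Gamma (x : R) : R :=
  epsilon (inhabits 0) (fun l => Un_cv (gauss_seq x) l).

Definition hyp_term (a b c z : R) (n : nat) : R :=
  poch a n * poch b n / (poch c n * INR (fact n)) * z ^ n.

Definition hyp_series (a b c z : R) : R :=
  epsilon (inhabits 0) (fun l => infinite_sum (hyp_term a b c z) l).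

(* 2F1 with its analytic continuation to the real half-line z < 1:
   - wherever the hypergeometric series converges (in particular |z| < 1,
     and everywhere when it terminates), its sum;
   - otherwise, for z < 1 (then z <= -1), the Pfaff transformation
     2F1(a,b;c;z) = (1-z)^(-a) 2F1(a,c-b;c;z/(z-1)), with z/(z-1) in (0,1). *)
Definition hyp2f1 (a b c z : R) : R :=
  if excluded_middle_informative (exists l, infinite_sum (hyp_term a b c z) l)
  then hyp_series a b c z
  else if Rlt_dec z 1
       then Rpower (1 - z) (- a) * hyp_series a (c - b) c (z / (z - 1))
       else 0.

Definition poly_eval (coef : nat -> R) (d : nat) (x : R) : R :=
  sum_f_R0 (fun i => coef i * x ^ i) d.

Definition contact_order (f g : R -> R) (N : nat) : Prop :=
  exists C delta, 0 < delta /\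
    forall x, 0 < x -> Rabs (x - 1) < delta ->
      Rabs (f x - g x) <= C * Rabs (x - 1) ^ N.

Definition rat_fun (m n : nat) (a b : nat -> R) (x : R) : R :=
  poly_eval a m x / poly_eval b n x.

(* (m,n)-Pade approximant of f at x = 1: a rational function p/q with
   deg p <= m, deg q <= n, q(1) <> 0, whose order of agreement with f at 1
   is the highest possible among all such rational functions. *)
Definition is_pade_at1 (f : R -> R) (m n : nat) (a b : nat -> R) : Prop :=
  poly_eval b n 1 <> 0 /\
  forall (a' b' : nat -> R) (N : nat),
    poly_eval b' n 1 <> 0 ->
    contact_order f (rat_fun m n a' b') N ->
    contact_order f (rat_fun m n a b) N.

Definition negpow (alpha : R) (x : R) : R := Rpower x (- alpha).

(* Main.v *)
(* Put [x = 1 - z], [(a)_n = poch a n] and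
   [Q x = sum_j C(k,j) x^j / ((alpha)_(k-j) (1-alpha)_j)].  By the binomial series the
   [n]-th Taylor coefficient at [z = 0] of [Q x * x^(-alpha)] is
   [1/n! * sum_j Q_j (alpha-j)_n], which for [n >= k] is [1/n!] times the [k]-th
   backward difference of the rising factorial [y |-> (y)_(n-k)] at [y = alpha + k].
   It vanishes for [k <= n < 2k] and afterwards is, up to the factor [k!/(2k)!], the
   coefficient of [2F1(k+1,k+alpha;2k+1;z)], so the Taylor polynomial [P] of degree
   [< k] and [Q] satisfy [Q x * x^(-alpha) - P = k!/(2k)! z^(2k) 2F1(...)].  A Pascal
   induction gives [(-z)^k 2F1(-k,k;alpha;1/z) = (1-alpha)_k Q x].

   Every Pade approximant [p/q] is a multiple of [P/Q]: with [P', Q'] the pair for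
   [k-1], both [Q P' - P Q'] and [q P' - p Q'] have degree at most [2k-2] and are
   [O(z^(2k-2))], hence are constants times [z^(2k-2)], and eliminating gives
   [c q = d Q], [c p = d P].

   For [z <= -1] the Pfaff transformation is the same identity for [1-alpha] at
   [z/(z-1)], because [x |-> 1/x] reverses [Q] and exchanges [alpha] with [1-alpha];
   at [z = -1] the series may converge, which is settled by Abel's theorem. *)
Require Import Defs.
From Stdlib Require Import Reals Lra Lia Arith ClassicalEpsilon.
From Coquelicot Require Import Coquelicot.
Open Scope R_scope.

(** * Rising factorials and the Pade denominator *)

Lemma poch_S_left (a : R) (n : nat) : poch a (S n) = a * poch (a + 1) n.
Proof.
  induction n as [|n IH]; [simpl; ring|].
  change (poch a (S (S n))) with (poch a (S n) * (a + INR (S n))).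
  rewrite IH, S_INR. simpl. ring.
Qed.

Lemma poch_add (a : R) (n m : nat) :
  poch a (n + m) = poch a n * poch (a + INR n) m.
Proof.
  induction m as [|m IH]; [rewrite Nat.add_0_r; simpl; ring|].
  rewrite Nat.add_succ_r. simpl. rewrite IH, plus_INR. ring.
Qed.

Lemma poch_neq_0 (a : R) (n : nat) :
  (forall i, (i < n)%nat -> a + INR i <> 0) -> poch a n <> 0.
Proof.
  induction n as [|n IH]; intros H; simpl; [lra|].
  apply Rmult_integral_contrapositive_currified; [apply IH; intros|]; apply H; lia.
Qed.

Lemma poch_pos (a : R) (n : nat) : 0 < a -> 0 < poch a n.
Proof.
  intros Ha; induction n as [|n IH]; simpl; [lra|].
  apply Rmult_lt_0_compat; [assumption|]. pose proof (pos_INR n); lra.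
Qed.

Lemma poch_reflect (a : R) (j : nat) :
  poch (a - INR j) j = (-1) ^ j * poch (1 - a) j.
Proof.
  induction j as [|j IH]; [simpl; ring|].
  rewrite poch_S_left, S_INR.
  replace (a - (INR j + 1) + 1) with (a - INR j) by ring.
  rewrite IH. simpl. ring.
Qed.

Lemma poch_INR_succ (k m : nat) :
  poch (INR k + 1) m * INR (fact k) = INR (fact (k + m)).
Proof.
  induction m as [|m IH]; [rewrite Nat.add_0_r; simpl; ring|].
  rewrite Nat.add_succ_r, fact_simpl, mult_INR, <- IH, S_INR, plus_INR.
  simpl. ring.
Qed.

Lemma poch_opp_INR (k i : nat) :
  (i <= k)%nat -> poch (- INR k) i = (-1) ^ i * INR (fact i) * Binomial.C k i.
Proof.
  intros Hi. unfold Binomial.C.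
  assert (Hf : forall n, INR (fact n) <> 0) by apply INR_fact_neq_0.
  (* Cleared of the denominator [(k - i)!], the claim survives an induction on [i] in which one
     factor of [(k - i)!] moves into the product at each step. *)
  enough (E : poch (- INR k) i * INR (fact (k - i)) = (-1) ^ i * INR (fact k))
    by (apply (Rmult_eq_reg_r (INR (fact (k - i)))); [rewrite E; field; auto | auto]).
  induction i as [|i IH]; [rewrite Nat.sub_0_r; simpl; ring|].
  specialize (IH ltac:(lia)).
  replace (k - i)%nat with (S (k - S i)) in IH by lia.
  rewrite fact_simpl, mult_INR in IH.
  assert (E : INR (S (k - S i)) = INR k - INR i)
    by (rewrite <- minus_INR by lia; f_equal; lia).
  rewrite E in IH. simpl.
  transitivity (- 1 * (poch (- INR k) i * ((INR k - INR i) * INR (fact (k - S i))))); [ring|].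
  rewrite IH. ring.
Qed.

Lemma poch_opp_INR_gt (k i : nat) : (k < i)%nat -> poch (- INR k) i = 0.
Proof.
  intros Hi. replace i with (S k + (i - S k))%nat by lia.
  rewrite poch_add. simpl. ring.
Qed.

(** Pascal's rule under a summation sign. All inductions on the order [k] of a backward difference
    or of a denominator rest on it. *)
Lemma sum_C_succ (f : nat -> R) (k : nat) :
  sum_f_R0 (fun i => Binomial.C (S k) i * f i) (S k)
  = sum_f_R0 (fun i => Binomial.C k i * (f i + f (S i))) k.
Proof.
  rewrite decomp_sum by lia. simpl pred.
  rewrite (sum_eq _ (fun i => Binomial.C k i * f i + Binomial.C k i * f (S i))
    k (fun i _ => Rmult_plus_distr_l _ _ _)), plus_sum.
  destruct k as [|k].
  { simpl. unfold Binomial.C. simpl. field. }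
  rewrite tech5.
  rewrite (sum_eq _ (fun i => Binomial.C (S k) (S i) * f (S i) + Binomial.C (S k) i * f (S i)) k)
    by (intros i Hi; rewrite <- pascal by lia; ring).
  rewrite plus_sum.
  rewrite (decomp_sum (fun i => Binomial.C (S k) i * f i) (S k)) by lia.
  rewrite (tech5 (fun i => Binomial.C (S k) i * f (S i))). simpl pred.
  (* Pascal's rule handles the interior indices only; the two end coefficients on each side equal
     1. *)
  replace (Binomial.C (S (S k)) 0) with 1
    by (unfold Binomial.C; rewrite Nat.sub_0_r; simpl fact at 2; simpl INR at 2; field; apply
        INR_fact_neq_0).
  replace (Binomial.C (S k) 0) with 1
    by (unfold Binomial.C; rewrite Nat.sub_0_r; simpl fact at 2; simpl INR at 2; field; apply
        INR_fact_neq_0).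
  replace (Binomial.C (S (S k)) (S (S k))) with 1
    by (unfold Binomial.C; rewrite Nat.sub_diag; simpl fact at 3; simpl INR at 3; field; apply
        INR_fact_neq_0).
  replace (Binomial.C (S k) (S k)) with 1
    by (unfold Binomial.C; rewrite Nat.sub_diag; simpl fact at 3; simpl INR at 3; field; apply
        INR_fact_neq_0).
  ring.
Qed.

Lemma C_pos (n i : nat) : 0 < Binomial.C n i.
Proof.
  unfold Binomial.C. apply Rdiv_lt_0_compat; [|apply Rmult_lt_0_compat]; apply INR_fact_lt_0.
Qed.

(** The two products share the factor [poch y m]; their remaining factors [y + m] and [y - 1] differ
    by [m + 1]. *)
Lemma poch_backward_diff (y : R) (m : nat) :
  poch y (S m) - poch (y - 1) (S m) = INR (S m) * poch y m.
Proof.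
  rewrite (poch_S_left (y - 1)). replace (y - 1 + 1) with y by ring.
  rewrite S_INR. simpl. ring.
Qed.

(** The [k]-th backward difference at [y] of the rising factorial of order [m]. *)
Definition diff_sum (k : nat) (y : R) (m : nat) : R :=
  sum_f_R0 (fun j => Binomial.C k j * ((-1) ^ j * poch (y - INR j) m)) k.

Lemma diff_sum_succ_0 (k : nat) (y : R) : diff_sum (S k) y 0 = 0.
Proof.
  unfold diff_sum. rewrite (sum_C_succ (fun j => (-1) ^ j * poch (y - INR j) 0)).
  rewrite (sum_eq _ (fun i => 0)) by (intros; simpl; ring).
  rewrite sum_cte. ring.
Qed.

Lemma diff_sum_succ_succ (k : nat) (y : R) (m : nat) :
  diff_sum (S k) y (S m) = INR (S m) * diff_sum k y m.
Proof.
  unfold diff_sum. rewrite (sum_C_succ (fun j => (-1) ^ j * poch (y - INR j) (S m))).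
  rewrite scal_sum. apply sum_eq. intros j _.
  rewrite (S_INR j). replace (y - (INR j + 1)) with (y - INR j - 1) by ring.
  transitivity (Binomial.C k j * (-1) ^ j * (poch (y - INR j) (S m) - poch (y - INR j - 1) (S m)));
    [simpl; ring|]. rewrite poch_backward_diff. ring.
Qed.

Lemma diff_sum_lt (k : nat) (y : R) (m : nat) : (m < k)%nat -> diff_sum k y m = 0.
Proof.
  revert m; induction k as [|k IH]; intros m H; [lia|].
  destruct m as [|m]; [apply diff_sum_succ_0|].
  rewrite diff_sum_succ_succ, IH by lia. ring.
Qed.

(** Each difference lowers the order by one and brings out that order as a factor, as
    differentiation does for monomials. *)
Lemma diff_sum_add (k : nat) (y : R) (m : nat) :
  diff_sum k y (k + m) * INR (fact m) = INR (fact (k + m)) * poch y m.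
Proof.
  induction k as [|k IH].
  - unfold diff_sum, Binomial.C. simpl. rewrite Rminus_0_r. field.
  - rewrite Nat.add_succ_l, diff_sum_succ_succ, fact_simpl, mult_INR.
    rewrite Rmult_assoc, IH. ring.
Qed.

(** The polynomial [Q] for [a = alpha], [b = 1 - alpha]. Independent [a] and [b] let a recursion on
    [k] shift one of them, and let the inversion of [x] exchange them. *)
Definition pade_den (a b : R) (k : nat) (x : R) : R :=
  sum_f_R0 (fun j => Binomial.C k j * (x ^ j / (poch a (k - j) * poch b j))) k.

(** After Pascal's rule, the first factor of the rising factorial of [a] comes out of one half of
    the sum, and that of [b] out of the other. *)
Lemma pade_den_succ (a b : R) (k : nat) (x : R) : 0 < a -> 0 < b ->
  pade_den a b (S k) x = / a * pade_den (a + 1) b k x + x / b * pade_den a (b + 1) k x.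
Proof.
  intros Ha Hb. unfold pade_den.
  rewrite (sum_C_succ (fun j => x ^ j / (poch a (S k - j) * poch b j))).
  rewrite !scal_sum, <- plus_sum. apply sum_eq. intros j Hj.
  replace (S k - j)%nat with (S (k - j)) by lia.
  replace (S k - S j)%nat with (k - j)%nat by lia.
  rewrite !poch_S_left.
  pose proof (poch_pos (a + 1) (k - j) ltac:(lra)).
  pose proof (poch_pos a (k - j) Ha).
  pose proof (poch_pos (b + 1) j ltac:(lra)).
  pose proof (poch_pos b j ltac:(lra)).
  simpl pow. field. repeat split; lra.
Qed.

(** The two terms of [pade_den_succ] have the same parameter [a + b + k], so their expansions add
    coefficientwise. For [a + b = 1] the numerators become [poch k (k - m)], those of
    [2F1(-k,k;a;.)] in reverse order. *)
Lemma pade_den_monomials (a b : R) (k : nat) (z : R) : 0 < a -> 0 < b ->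
  pade_den a b k (1 - z)
  = sum_f_R0 (fun m => Binomial.C k m *
      ((- z) ^ m * (poch (a + b + INR k - 1) (k - m) / (poch a (k - m) * poch b k)))) k.
Proof.
  revert a b; induction k as [|k IH]; intros a b Ha Hb.
  { unfold pade_den; simpl. field. }
  rewrite pade_den_succ, !IH by lra.
  rewrite (sum_C_succ (fun m => (- z) ^ m * (poch (a + b + INR (S k) - 1) (S k - m)
      / (poch a (S k - m) * poch b (S k))))).
  rewrite !scal_sum, <- plus_sum. apply sum_eq. intros m Hm.
  replace (S k - m)%nat with (S (k - m)) by lia.
  replace (S k - S m)%nat with (k - m)%nat by lia.
  rewrite S_INR.
  replace (a + 1 + b + INR k - 1) with (a + b + INR k) by ring.
  replace (a + (b + 1) + INR k - 1) with (a + b + INR k) by ring.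
  replace (a + b + (INR k + 1) - 1) with (a + b + INR k) by ring.
  assert (Ea : poch (a + 1) (k - m) = poch a (k - m) * (a + INR (k - m)) / a)
    by (pose proof (poch_S_left a (k - m)) as E; simpl in E; rewrite E; field; lra).
  assert (Eb : poch (b + 1) k = poch b k * (b + INR k) / b)
    by (pose proof (poch_S_left b k) as E; simpl in E; rewrite E; field; lra).
  rewrite Ea, Eb. simpl poch. simpl pow. rewrite minus_INR by lia.
  pose proof (poch_pos a (k - m) Ha). pose proof (poch_pos b k Hb).
  pose proof (pos_INR k). pose proof (pos_INR (k - m)) as Hkm.
  rewrite minus_INR in Hkm by lia.
  field. repeat split; lra.
Qed.

Lemma sum_rev (f : nat -> R) (n : nat) :
  sum_f_R0 (fun i => f (n - i)%nat) n = sum_f_R0 f n.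
Proof.
  revert f. induction n as [|n IH]; intros f; [reflexivity|].
  rewrite decomp_sum by lia. simpl pred. rewrite Nat.sub_0_r.
  rewrite (sum_eq _ (fun i => f (n - i)%nat)) by (intros; f_equal; lia).
  rewrite IH, tech5. ring.
Qed.

Lemma pade_den_rev (a b : R) (k : nat) (x : R) : x <> 0 ->
  pade_den a b k x = x ^ k * pade_den b a k (/ x).
Proof.
  intros Hx. unfold pade_den. rewrite <- sum_rev, scal_sum. apply sum_eq. intros j Hj.
  rewrite <- pascal_step1 by lia.
  replace (k - (k - j))%nat with j by lia.
  replace (x ^ k) with (x ^ (k - j) * x ^ j) by (rewrite <- pow_add; f_equal; lia).
  rewrite pow_inv. unfold Rdiv.
  replace (x ^ (k - j) * / (poch a j * poch b (k - j)))
    with (/ (poch b (k - j) * poch a j) * x ^ (k - j) * (x ^ j * / x ^ j));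
    [ring | rewrite Rinv_r by (apply pow_nonzero; assumption); rewrite (Rmult_comm (poch b _));
        ring].
Qed.

Lemma pade_den_pos (a b : R) (k : nat) (x : R) : 0 < a -> 0 < b -> 0 < x -> 0 < pade_den a b k x.
Proof.
  intros Ha Hb Hx.
  assert (T : forall j, 0 < Binomial.C k j * (x ^ j / (poch a (k - j) * poch b j))).
  { intros j. apply Rmult_lt_0_compat; [apply C_pos|].
    apply Rdiv_lt_0_compat; [apply pow_lt; assumption|].
    apply Rmult_lt_0_compat; apply poch_pos; assumption. }
  unfold pade_den. generalize k at 3. intros n. induction n as [|n IH]; simpl; [apply T|].
  pose proof (T (S n)). simpl in *. lra.
Qed.

(** * Gauss' limit for the gamma function *)

Lemma bernoulli_le_1 (x t : R) : 0 <= x <= 1 -> 0 <= t -> Rpower (1 + t) x <= 1 + x * t.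
Proof.
  intros [H0 H1] Ht.
  (* Concavity of [ln] at [1 + x t = x (1 + t) + (1 - x)], from the tangent bound [ln u <= u
      - 1]. *)
  assert (Hp : 0 < 1 + x * t) by nra.
  rewrite <- (exp_ln (1 + x * t)) by assumption. unfold Rpower.
  assert (L : forall u, 0 < u -> ln u <= u - 1).
  { intros u Hu. pose proof (exp_ineq1_le (ln u)) as E. rewrite exp_ln in E; lra. }
  pose proof (L ((1 + t) / (1 + x * t)) ltac:(apply Rdiv_lt_0_compat; lra)) as L1.
  pose proof (L (/ (1 + x * t)) ltac:(apply Rinv_0_lt_compat; lra)) as L2.
  unfold Rdiv in L1. rewrite ln_mult, ln_Rinv in L1 by (try apply Rinv_0_lt_compat; lra).
  rewrite ln_Rinv in L2 by lra.
  assert (E : x * ((1 + t) * / (1 + x * t) - 1) + (1 - x) * (/ (1 + x * t) - 1)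
      = 0) by (field; lra).
  assert (x * ln (1 + t) <= ln (1 + x * t)) by nra.
  destruct (Rle_lt_or_eq_dec _ _ H) as [H'|H'].
  - left; apply exp_increasing; assumption.
  - rewrite H'; lra.
Qed.

(** Combines [ln (1 + t) >= t / (1 + t)] with [exp u >= 1 + u]. It yields the monotonicity of Gauss'
    sequence. *)
Lemma bernoulli_inv_ge (x t : R) : 0 <= x -> 0 <= t -> 1 + x * (t / (1 + t)) <= Rpower (1 + t) x.
Proof.
  intros Hx Ht.
  assert (L : t / (1 + t) <= ln (1 + t)).
  { assert (0 < / (1 + t)) by (apply Rinv_0_lt_compat; lra).
    pose proof (exp_ineq1_le (ln (/ (1 + t)))) as E.
    rewrite exp_ln in E by assumption. rewrite ln_Rinv in E by lra.
    replace (t / (1 + t)) with (1 - / (1 + t)) by (field; lra). lra. }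
  unfold Rpower. eapply Rle_trans; [|apply exp_ineq1_le].
  apply Rplus_le_compat_l, Rmult_le_compat_l; assumption.
Qed.

Lemma gauss_seq_pos (x : R) (n : nat) : 0 < x -> 0 < gauss_seq x n.
Proof.
  intros Hx. unfold gauss_seq. apply Rdiv_lt_0_compat; [|apply poch_pos; assumption].
  apply Rmult_lt_0_compat; [apply INR_fact_lt_0 | apply exp_pos].
Qed.

(** Reduces the comparison of consecutive terms to that of [(1 + 1/m)^x] with [1 + x/(m + 1)], where
    [m = n + 1] avoids the reciprocal of 0. *)
Lemma gauss_seq_step (x : R) (n : nat) : 0 < x ->
  gauss_seq x (S (S n)) * (1 + x / INR (S (S n)))
  = gauss_seq x (S n) * Rpower (1 + / INR (S n)) x.
Proof.
  intros Hx. unfold gauss_seq.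
  pose proof (lt_0_INR (S n) ltac:(lia)) as Hn.
  assert (En : INR (S (S n)) = INR (S n) + 1) by apply S_INR.
  assert (E : Rpower (INR (S (S n))) x = Rpower (INR (S n)) x * Rpower (1 + / INR (S n)) x).
  { rewrite Rpower_mult_distr;
      [f_equal; rewrite En; field; lra | assumption | apply Rplus_lt_0_compat, Rinv_0_lt_compat;
          lra]. }
  rewrite E, fact_simpl, mult_INR.
  change (poch x (S (S (S n)))) with (poch x (S (S n)) * (x + INR (S (S n)))).
  pose proof (poch_pos x (S (S n)) Hx).
  rewrite En. field. repeat split; lra.
Qed.

(** The sequence increases from index 1 on, while its product with [1 + x/m] decreases by
    Bernoulli's inequality for exponents at most 1; so it is bounded, and its limit is at least the
    positive first term. *)
Lemma gauss_seq_cv_0_1 (x : R) : 0 < x < 1 -> exists l, 0 < l /\ Un_cv (gauss_seq x) l.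
Proof.
  intros Hx.
  set (g := fun n => gauss_seq x (S n)).
  assert (Hg : Un_growing g).
  { intros n. unfold g.
    pose proof (lt_0_INR (S n) ltac:(lia)) as Hn.
    pose proof (gauss_seq_step x n ltac:(lra)) as E.
    pose proof (bernoulli_inv_ge x (/ INR (S n)) ltac:(lra)
      ltac:(left; apply Rinv_0_lt_compat; lra)) as B.
    replace (/ INR (S n) / (1 + / INR (S n))) with (/ INR (S (S n))) in B
      by (rewrite (S_INR (S n)); field; lra).
    fold (x / INR (S (S n))) in B.
    pose proof (gauss_seq_pos x (S n) ltac:(lra)).
    assert (0 < x / INR (S (S n))) by (apply Rdiv_lt_0_compat; [lra | apply lt_0_INR; lia]).
    apply (Rmult_le_reg_r (1 + x / INR (S (S n)))); [lra|]. rewrite E.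
    apply Rmult_le_compat_l; lra. }
  assert (Hh : forall n, g n * (1 + x / INR (S n)) <= g 0%nat * (1 + x)).
  { induction n as [|n IH]; [simpl INR; unfold Rdiv; rewrite Rinv_1; lra|].
    eapply Rle_trans; [|exact IH]. unfold g.
    rewrite gauss_seq_step by lra.
    pose proof (gauss_seq_pos x (S n) ltac:(lra)).
    apply Rmult_le_compat_l; [lra|].
    apply bernoulli_le_1; [lra | left; apply Rinv_0_lt_compat, lt_0_INR; lia]. }
  assert (Hb : has_ub g).
  { exists (g 0%nat * (1 + x)). intros y [n ->].
    eapply Rle_trans; [|apply (Hh n)].
    pose proof (gauss_seq_pos x (S n) ltac:(lra)). unfold g.
    assert (0 < x / INR (S n)) by (apply Rdiv_lt_0_compat; [lra | apply lt_0_INR; lia]).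
    nra. }
  destruct (growing_cv g Hg Hb) as [l Hl]. exists l. split.
  - apply Rlt_le_trans with (g 0%nat); [apply gauss_seq_pos; lra|].
    apply growing_ineq; assumption.
  - apply is_lim_seq_Reals. apply is_lim_seq_incr_1. apply is_lim_seq_Reals. exact Hl.
Qed.

(** The functional equation at the level of terms: the term for [x + 1] is [x] times the term for
    [x] times [n / (n + x + 1)], and the last factor tends to 1. *)
Lemma gauss_seq_shift (x l : R) : 0 < x ->
  Un_cv (gauss_seq x) l -> Un_cv (gauss_seq (x + 1)) (x * l).
Proof.
  intros Hx Hl. apply is_lim_seq_Reals in Hl. apply is_lim_seq_Reals.
  apply is_lim_seq_incr_1.
  apply (is_lim_seq_ext (fun n => x * gauss_seq x (S n) * (INR (S n) / (INR (S n) + (x + 1))))).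
  { intros n. unfold gauss_seq.
    pose proof (lt_0_INR (S n) ltac:(lia)) as Hn.
    rewrite Rpower_plus, Rpower_1 by assumption.
    pose proof (poch_S_left x (S (S n))) as E.
    change (poch x (S (S (S n)))) with (poch x (S (S n)) * (x + INR (S (S n)))) in E.
    pose proof (poch_pos x (S (S n)) Hx). pose proof (poch_pos (x + 1) (S (S n)) ltac:(lra)).
    replace (poch (x + 1) (S (S n))) with (poch x (S (S n)) * (x + INR (S (S n))) / x)
      by (rewrite E; field; lra).
    rewrite (S_INR (S n)). field. repeat split; lra. }
  replace (Finite (x * l)) with (Finite (x * l * 1)) by (f_equal; ring).
  apply is_lim_seq_mult'.
  { apply (is_lim_seq_scal_l _ x (Finite l)). apply is_lim_seq_incr_1 in Hl. exact Hl. }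
  apply (is_lim_seq_ext (fun n => / (1 + (x + 1) * / INR (S n)))).
  { intros n. pose proof (lt_0_INR (S n) ltac:(lia)) as Hn. field. split; lra. }
  replace (Finite 1) with (Rbar_inv (Finite (1 + (x + 1) * 0))) by (simpl; f_equal; field).
  apply is_lim_seq_inv; [|simpl; intros E; injection E; lra].
  apply is_lim_seq_plus'; [apply is_lim_seq_const|].
  apply (is_lim_seq_scal_l _ (x + 1) (Finite 0)).
  apply (is_lim_seq_incr_1 (fun n => / INR n)).
  replace (Finite 0) with (Rbar_inv p_infty) by reflexivity.
  apply is_lim_seq_inv; [apply is_lim_seq_INR | discriminate].
Qed.

Lemma gauss_seq_cv_1 : Un_cv (gauss_seq 1) 1.
Proof.
  apply is_lim_seq_Reals. apply is_lim_seq_incr_1.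
  apply (is_lim_seq_ext (fun n => 1 - / INR (S (S n)))).
  { intros n. unfold gauss_seq. pose proof (lt_0_INR (S n) ltac:(lia)) as Hn.
    rewrite Rpower_1 by assumption.
    pose proof (poch_INR_succ 0 (S (S n))) as E. simpl (INR 0) in E.
    rewrite Rplus_0_l in E. replace (INR (fact 0)) with 1 in E by reflexivity. rewrite Rmult_1_r
        in E.
    rewrite E. change (0 + S (S n))%nat with (S (S n)).
    rewrite (fact_simpl (S n)), mult_INR. pose proof (INR_fact_lt_0 (S n)).
    rewrite (S_INR (S n)). field. lra. }
  replace (Finite 1) with (Finite (1 - 0)) by (f_equal; ring).
  apply is_lim_seq_minus'; [apply is_lim_seq_const|].
  apply (is_lim_seq_incr_1 (fun n => / INR (S n))), (is_lim_seq_incr_1 (fun n => / INR n)).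
  replace (Finite 0) with (Rbar_inv p_infty) by reflexivity.
  apply is_lim_seq_inv; [apply is_lim_seq_INR | discriminate].
Qed.

Lemma Gamma_unique (x l : R) : Un_cv (gauss_seq x) l -> Gamma x = l.
Proof.
  intros H. unfold Gamma. eapply UL_sequence; [|exact H].
  apply epsilon_spec. exists l; exact H.
Qed.

Lemma gauss_seq_poch (x l : R) (k : nat) : 0 < x ->
  Un_cv (gauss_seq x) l -> Un_cv (gauss_seq (INR k + x)) (poch x k * l).
Proof.
  intros Hx H. induction k as [|k IH].
  - simpl. rewrite Rplus_0_l, Rmult_1_l. exact H.
  - rewrite S_INR. simpl. replace (INR k + 1 + x) with (INR k + x + 1) by ring.
    replace (poch x k * (x + INR k) * l) with ((INR k + x) * (poch x k * l)) by ring.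
    apply gauss_seq_shift; [pose proof (pos_INR k); lra | exact IH].
Qed.

Lemma Gamma_INR_succ (n : nat) : Gamma (INR n + 1) = INR (fact n).
Proof.
  rewrite (Gamma_unique _ (poch 1 n * 1)) by (apply gauss_seq_poch; [lra | apply gauss_seq_cv_1]).
  pose proof (poch_INR_succ 0 n) as E. simpl in E. rewrite Rplus_0_l in E. rewrite <- E. ring.
Qed.

(** The functional equation applied [k] times; positivity of the limit at [x] permits the
    division. *)
Lemma Gamma_quotient (x : R) (k : nat) : 0 < x < 1 -> Gamma (INR k + x) / Gamma x = poch x k.
Proof.
  intros Hx. destruct (gauss_seq_cv_0_1 x Hx) as [l [Hl H]].
  rewrite (Gamma_unique _ _ H), (Gamma_unique _ _ (gauss_seq_poch x l k ltac:(lra) H)).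
  field. lra.
Qed.

(** * Power series expansion of the error *)

(** [hyp_term] without its power of [z], so that the theory of power series applies. *)
Definition hyp_coef (a b c : R) (n : nat) : R :=
  poch a n * poch b n / (poch c n * INR (fact n)).

Lemma is_lim_ratio_1 (a b : R) : 0 < b ->
  is_lim_seq (fun n => (a + INR n) / (b + INR n)) 1.
Proof.
  intros Hb.
  apply (is_lim_seq_ext (fun n => 1 + (a - b) * / (b + INR n))).
  { intros n. pose proof (pos_INR n). field. lra. }
  replace (Finite 1) with (Finite (1 + (a - b) * 0)) by (f_equal; ring).
  apply is_lim_seq_plus'; [apply is_lim_seq_const|].
  apply (is_lim_seq_scal_l _ (a - b) (Finite 0)).
  replace (Finite 0) with (Rbar_inv p_infty) by reflexivity.
  apply is_lim_seq_inv; [|discriminate].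
  eapply is_lim_seq_plus; [apply is_lim_seq_const | apply is_lim_seq_INR | reflexivity].
Qed.

(** Ratio test: consecutive coefficients have ratio [(a+n)(b+n) / ((c+n)(1+n))], which tends to 1.
    The conditions on [a] and [b] keep the coefficients nonzero, as the test demands. *)
Lemma CV_radius_hyp_coef (a b c : R) :
  (forall n, a + INR n <> 0) -> (forall n, b + INR n <> 0) -> 0 < c ->
  CV_radius (hyp_coef a b c) = 1.
Proof.
  intros Ha Hb Hc.
  assert (Pa : forall n, poch a n <> 0) by (intros; apply poch_neq_0; auto).
  assert (Pb : forall n, poch b n <> 0) by (intros; apply poch_neq_0; auto).
  assert (Pc : forall n, poch c n <> 0) by (intros n; pose proof (poch_pos c n Hc); lra).
  assert (Pf : forall n, INR (fact n) <> 0) by apply INR_fact_neq_0.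
  assert (Pn : forall n, hyp_coef a b c n <> 0).
  { intros n. unfold hyp_coef, Rdiv.
    repeat apply Rmult_integral_contrapositive_currified; auto.
    apply Rinv_neq_0_compat, Rmult_integral_contrapositive_currified; auto. }
  replace (Finite 1) with (Finite (/ 1)) by (f_equal; field).
  apply CV_radius_finite_DAlembert; [assumption | lra |].
  replace (Finite 1) with (Rbar_abs (Finite (1 * 1))) by (simpl; f_equal; rewrite Rmult_1_l;
      apply Rabs_R1).
  apply is_lim_seq_abs.
  apply (is_lim_seq_ext (fun n => (a + INR n) / (c + INR n) * ((b + INR n) / (1 + INR n)))).
  - intros n. unfold hyp_coef. rewrite fact_simpl, mult_INR, S_INR. simpl poch.
    pose proof (pos_INR n). field. repeat split; auto; lra.
  - apply is_lim_seq_mult'; apply is_lim_ratio_1; lra.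
Qed.

Definition binom_coef (b : R) (n : nat) : R := poch b n / INR (fact n).

(** The binomial series is the case [2F1(b,1;1;z)]. *)
Lemma CV_radius_binom_coef (b : R) :
  (forall n, b + INR n <> 0) -> CV_radius (binom_coef b) = 1.
Proof.
  intros Hb. rewrite <- (CV_radius_hyp_coef b 1 1);
    [|assumption | intros n; pose proof (pos_INR n); lra | lra].
  apply CV_radius_ext. intros n. unfold binom_coef, hyp_coef.
  pose proof (poch_pos 1 n Rlt_0_1). pose proof (INR_fact_lt_0 n). field; lra.
Qed.

Lemma binom_PSeries_ODE (b z : R) : (forall n, b + INR n <> 0) -> Rabs z < 1 ->
  (1 - z) * PSeries (PS_derive (binom_coef b)) z = b * PSeries (binom_coef b) z.
Proof.
  intros Hb Hz.
  assert (Ha : ex_pseries (binom_coef b) z)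
    by (apply CV_radius_inside; rewrite CV_radius_binom_coef by assumption; exact Hz).
  assert (Hd : ex_pseries (PS_derive (binom_coef b)) z).
  { apply CV_radius_inside. rewrite CV_radius_derive, CV_radius_binom_coef by assumption. exact
      Hz. }
  enough (E : PSeries (PS_derive (binom_coef b)) z
    = b * PSeries (binom_coef b) z + z * PSeries (PS_derive (binom_coef b)) z) by lra.
  rewrite <- PSeries_incr_1, <- PSeries_scal, <- PSeries_plus.
  - apply PSeries_ext. intros n. unfold PS_plus, PS_scal, PS_derive, PS_incr_1, binom_coef.
    change plus with Rplus. change scal with Rmult.
    assert (Pf : forall n, INR (fact n) <> 0) by apply INR_fact_neq_0.
    destruct n as [|n]; [change (zero : R) with 0; simpl; field|].
    rewrite (fact_simpl (S n)), mult_INR. pose proof (pos_INR n).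
    change (poch b (S (S n))) with (poch b (S n) * (b + INR (S n))).
    rewrite (S_INR (S n)), (S_INR n). field. split; [auto|lra].
  - apply ex_pseries_scal; [unfold mult; simpl; ring | assumption].
  - apply ex_pseries_incr_1; assumption.
Qed.

(** By the differential equation, the series times [(1 - z)^b] has derivative zero on the unit
    interval around 0, and its value at 0 is 1. *)
Lemma binom_PSeries (b z : R) : (forall n, b + INR n <> 0) -> Rabs z < 1 ->
  PSeries (binom_coef b) z = Rpower (1 - z) (- b).
Proof.
  intros Hb Hz.
  set (h := fun t => PSeries (binom_coef b) t * Rpower (1 - t) b).
  assert (Hh : forall t, Rabs t < 1 -> is_derive h t zero).
  { intros t Ht. apply Rabs_def2 in Ht as Ht'.
    assert (H1 : is_derive (PSeries (binom_coef b)) t (PSeries (PS_derive (binom_coef b)) t))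
      by (apply is_derive_PSeries; rewrite CV_radius_binom_coef by assumption; exact Ht).
    assert (H2 : is_derive (fun t => Rpower (1 - t) b) t (- b * Rpower (1 - t) b / (1 - t))).
    { unfold Rpower. auto_derive; [lra|]. fold (1 - t). field. lra. }
    assert (H3 := is_derive_mult _ _ t _ _ H1 H2 Rmult_comm).
    replace (@zero R_NormedModule) with
      (PSeries (PS_derive (binom_coef b)) t * Rpower (1 - t) b +
       PSeries (binom_coef b) t * (- b * Rpower (1 - t) b / (1 - t))); [exact H3|].
    pose proof (binom_PSeries_ODE b t Hb Ht) as E.
    change zero with 0.
    replace (PSeries (PS_derive (binom_coef b)) t) with (b * PSeries (binom_coef b) t / (1 - t))
      by (rewrite <- E; field; lra).
    field; lra. }
  assert (E : h z = h 0).
  { apply Rabs_def2 in Hz. destruct (Rtotal_order z 0) as [H|[->|H]]; [|reflexivity|].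
    - apply (eq_is_derive h z 0); [|assumption]. intros t Ht; apply Hh, Rabs_def1; lra.
    - symmetry. apply (eq_is_derive h 0 z); [|assumption]. intros t Ht; apply Hh, Rabs_def1; lra. }
  unfold h in E. rewrite PSeries_0 in E.
  replace (Rpower (1 - 0) b) with 1 in E
    by (unfold Rpower; rewrite Rminus_0_r, ln_1, Rmult_0_r, exp_0; reflexivity).
  rewrite Rpower_Ropp.
  assert (P : 0 < Rpower (1 - z) b) by apply exp_pos.
  apply (Rmult_eq_reg_r (Rpower (1 - z) b)); [|lra].
  rewrite E. unfold binom_coef. simpl. field. lra.
Qed.

Lemma is_pseries_sum (a : nat -> nat -> R) (q l : nat -> R) (z : R) (k : nat) :
  (forall j, (j <= k)%nat -> is_pseries (a j) z (l j)) ->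
  is_pseries (fun n => sum_f_R0 (fun j => q j * a j n) k) z (sum_f_R0 (fun j => q j * l j) k).
Proof.
  intros H. induction k as [|k IH]; simpl.
  - apply (is_pseries_scal (q 0%nat) (a 0%nat) z (l 0%nat)); [apply Rmult_comm | apply H; lia].
  - apply (is_pseries_plus (fun n => sum_f_R0 (fun j => q j * a j n) k)
      (fun n => q (S k) * a (S k) n)).
    + apply IH. intros; apply H; lia.
    + apply (is_pseries_scal (q (S k)) (a (S k)) z (l (S k))); [apply Rmult_comm | apply H; lia].
Qed.

Definition pade_coef (al : R) (k n : nat) : R :=
  sum_f_R0 (fun j => Binomial.C k j / (poch al (k - j) * poch (1 - al) j)
                     * binom_coef (al - INR j) n) k.

Lemma nonint_plus_nat (al : R) (j n : nat) : 0 < al < 1 -> al - INR j + INR n <> 0.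
Proof.
  intros Hal E. destruct (le_lt_dec j n) as [H|H].
  - apply le_INR in H. lra.
  - apply (le_INR (S n)) in H. rewrite S_INR in H. lra.
Qed.

Lemma is_pseries_pade_coef (al : R) (k : nat) (z : R) : 0 < al < 1 -> Rabs z < 1 ->
  is_pseries (pade_coef al k) z (pade_den al (1 - al) k (1 - z) * Rpower (1 - z) (- al)).
Proof.
  intros Hal Hz.
  replace (pade_den al (1 - al) k (1 - z) * Rpower (1 - z) (- al))
    with (sum_f_R0 (fun j => Binomial.C k j / (poch al (k - j) * poch (1 - al) j)
                     * Rpower (1 - z) (- (al - INR j))) k).
  - apply is_pseries_sum. intros j _.
    pose proof (fun n => nonint_plus_nat al j n Hal).
    rewrite <- binom_PSeries by assumption.
    apply PSeries_correct, CV_radius_inside. rewrite CV_radius_binom_coef by assumption. exact Hz.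
  - unfold pade_den. rewrite Rmult_comm, scal_sum. apply sum_eq. intros j _.
    apply Rabs_def2 in Hz.
    replace (- (al - INR j)) with (INR j + - al) by ring.
    rewrite Rpower_plus, Rpower_pow by lra. unfold Rdiv. ring.
Qed.

(** This is what dictates the coefficients of [Q]: the rising factorial of [al - j] splits into
    blocks of lengths [j], [k - j] and [m], and the first two cancel the denominators of [Q] up to
    the sign [(-1)^j]. The last block is the term of a backward difference. *)
Lemma pade_coef_add (al : R) (k m : nat) : 0 < al < 1 ->
  pade_coef al k (k + m) = diff_sum k (al + INR k) m / INR (fact (k + m)).
Proof.
  intros Hal. unfold pade_coef, diff_sum, Rdiv at 2. rewrite Rmult_comm, scal_sum.
  apply sum_eq. intros j Hj. unfold binom_coef.
  replace (poch (al - INR j) (k + m)) with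
    ((-1) ^ j * poch (1 - al) j * poch al (k - j) * poch (al + INR k - INR j) m).
  - pose proof (poch_pos al (k - j) ltac:(lra)). pose proof (poch_pos (1 - al) j ltac:(lra)).
    pose proof (INR_fact_lt_0 (k + m)). field. lra.
  - replace (k + m)%nat with (j + (k - j + m))%nat by lia.
    rewrite !poch_add, poch_reflect, minus_INR by lia.
    replace (al - INR j + INR j) with al by ring.
    replace (al + (INR k - INR j)) with (al + INR k - INR j) by ring. ring.
Qed.

Lemma pade_coef_gap (al : R) (k m : nat) : 0 < al < 1 -> (m < k)%nat ->
  pade_coef al k (k + m) = 0.
Proof.
  intros Hal Hm. rewrite pade_coef_add, diff_sum_lt by assumption. unfold Rdiv. ring.
Qed.

Definition lead_const (k : nat) : R := INR (fact k) / INR (fact (2 * k)).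

(** Here [(k+m)! = k! (k+1)_m] supplies one upper parameter and [(2k+m)! = (2k)! (2k+1)_m] the lower
    one; the other upper parameter [k + al] is the point of the difference. *)
Lemma pade_coef_tail (al : R) (k m : nat) : 0 < al < 1 ->
  pade_coef al k (2 * k + m)
  = lead_const k * hyp_coef (INR k + 1) (INR k + al) (2 * INR k + 1) m.
Proof.
  intros Hal. replace (2 * k + m)%nat with (k + (k + m))%nat by lia.
  rewrite pade_coef_add by assumption.
  pose proof (INR_fact_lt_0 m) as Hm.
  pose proof (INR_fact_lt_0 k) as Hk.
  pose proof (INR_fact_lt_0 (2 * k)) as H2k.
  pose proof (INR_fact_lt_0 (2 * k + m)) as H2km.
  replace (diff_sum k (al + INR k) (k + m)) with (INR (fact (k + m)) * poch (al + INR k) m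
      / INR (fact m))
    by (rewrite <- diff_sum_add; field; lra).
  unfold lead_const, hyp_coef.
  rewrite <- (poch_INR_succ k m).
  replace (k + (k + m))%nat with (2 * k + m)%nat by lia.
  rewrite <- (poch_INR_succ (2 * k) m), mult_INR. change (INR 2) with 2. rewrite (Rplus_comm al).
  pose proof (pos_INR k).
  pose proof (poch_pos (2 * INR k + 1) m ltac:(lra)).
  field. repeat split; lra.
Qed.

(** Counting terms instead of naming the last index makes the empty sum available, which is the
    numerator for [k = 0]. *)
Fixpoint psum (u : nat -> R) (n : nat) (z : R) : R :=
  match n with O => 0 | S m => psum u m z + u m * z ^ m end.

Lemma psum_gap (u : nat -> R) (n m : nat) (z : R) :
  (forall i, (i < m)%nat -> u (n + i)%nat = 0) -> psum u (n + m) z = psum u n z.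
Proof.
  induction m as [|m IH]; intros H; [rewrite Nat.add_0_r; reflexivity|].
  rewrite Nat.add_succ_r. simpl. rewrite IH, H by (auto; lia). ring.
Qed.

Lemma PSeries_split (u : nat -> R) (n : nat) (z : R) : ex_pseries u z ->
  PSeries u z = psum u n z + z ^ n * PSeries (fun i => u (n + i)%nat) z.
Proof.
  intros H.
  (* Convergence of the shifted series is carried along, since splitting off the next term requires
     it. *)
  enough (E : ex_pseries (fun i => u (n + i)%nat) z /\
    PSeries u z = psum u n z + z ^ n * PSeries (fun i => u (n + i)%nat) z) by apply E.
  induction n as [|n [IH1 IH2]].
  - split; [exact H|].
    change (PSeries (fun i => u (0 + i)%nat) z) with (PSeries u z). simpl. ring.
  - assert (Ei : forall i, PS_decr_1 (fun i => u (n + i)%nat) i = u (S n + i)%nat)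
      by (intros i; unfold PS_decr_1; f_equal; lia).
    split.
    + eapply ex_pseries_ext; [exact Ei|]. apply (ex_pseries_decr_1 (fun i => u (n
        + i)%nat)); [|exact IH1].
      destruct (Req_dec z 0) as [->|Hz]; [left; reflexivity|].
      right. exists (/ z). unfold mult, one; simpl. field; assumption.
    + rewrite IH2, PSeries_decr_1 by exact IH1. rewrite (PSeries_ext _ _ _ Ei), Nat.add_0_r.
      simpl. ring.
Qed.

Definition pade_num (al : R) (k : nat) (z : R) : R := psum (pade_coef al k) k z.

Definition tail_PSeries (al : R) (k : nat) (z : R) : R :=
  PSeries (hyp_coef (INR k + 1) (INR k + al) (2 * INR k + 1)) z.

Lemma CV_radius_tail (al : R) (k : nat) : 0 < al < 1 ->
  CV_radius (hyp_coef (INR k + 1) (INR k + al) (2 * INR k + 1)) = 1.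
Proof.
  intros Hal. pose proof (pos_INR k). apply CV_radius_hyp_coef; [| |lra];
  intros n; pose proof (pos_INR n); lra.
Qed.

Lemma pade_error (al : R) (k : nat) (z : R) : 0 < al < 1 -> Rabs z < 1 ->
  pade_den al (1 - al) k (1 - z) * Rpower (1 - z) (- al)
  = pade_num al k z + lead_const k * z ^ (2 * k) * tail_PSeries al k z.
Proof.
  intros Hal Hz. pose proof (is_pseries_pade_coef al k z Hal Hz) as H.
  rewrite <- (is_pseries_unique _ _ _ H).
  rewrite (PSeries_split _ (2 * k)) by (eexists; exact H).
  unfold pade_num, tail_PSeries.
  replace (psum (pade_coef al k) (2 * k) z) with (psum (pade_coef al k) k z).
  - rewrite (PSeries_ext _ (PS_scal (lead_const k) (hyp_coef (INR k + 1) (INR k + al) (2 * INR k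
      + 1))))
      by (intros m; apply pade_coef_tail; assumption).
    rewrite PSeries_scal. ring.
  - replace (2 * k)%nat with (k + k)%nat by lia. symmetry. apply psum_gap.
    intros; apply pade_coef_gap; assumption.
Qed.

(** * Uniqueness of the Pade approximant *)

(** Polynomial functions of degree at most [d] in Horner form: closure properties and orders of
    vanishing at 0 follow by peeling off constant terms. *)
Fixpoint pol (d : nat) (f : R -> R) : Prop :=
  match d with
  | O => exists c, forall z, f z = c
  | S d => exists c g, pol d g /\ forall z, f z = c + z * g z
  end.

Lemma pol_ext (d : nat) (f g : R -> R) : (forall z, f z = g z) -> pol d f -> pol d g.
Proof.
  intros E. destruct d as [|d]; simpl.
  - intros [c H]. exists c. intros; rewrite <- E; auto.
  - intros [c [h [Hh H]]]. exists c, h. split; [exact Hh|]. intros; rewrite <- E; auto.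
Qed.

Lemma pol_const (d : nat) (c : R) : pol d (fun _ => c).
Proof.
  revert c; induction d as [|d IH]; intros c; simpl; [exists c; auto|].
  exists c, (fun _ => 0). split; [apply IH | intros; ring].
Qed.

Lemma pol_plus (d : nat) (f g : R -> R) : pol d f -> pol d g -> pol d (fun z => f z + g z).
Proof.
  revert f g; induction d as [|d IH]; simpl; intros f g.
  - intros [c Hc] [e He]. exists (c + e). intros; rewrite Hc, He; ring.
  - intros [c [f' [Hf Ef]]] [e [g' [Hg Eg]]]. exists (c + e), (fun z => f' z + g' z).
    split; [apply IH; assumption|]. intros; rewrite Ef, Eg; ring.
Qed.

Lemma pol_scal (d : nat) (c : R) (f : R -> R) : pol d f -> pol d (fun z => c * f z).
Proof.
  revert f; induction d as [|d IH]; simpl; intros f.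
  - intros [e He]. exists (c * e). intros; rewrite He; ring.
  - intros [e [g [Hg Eg]]]. exists (c * e), (fun z => c * g z).
    split; [apply IH; assumption|]. intros; rewrite Eg; ring.
Qed.

Lemma pol_minus (d : nat) (f g : R -> R) : pol d f -> pol d g -> pol d (fun z => f z - g z).
Proof.
  intros Hf Hg. apply (pol_ext _ (fun z => f z + -1 * g z)); [intros; ring|].
  apply pol_plus, pol_scal; assumption.
Qed.

Lemma pol_mulX (d : nat) (f : R -> R) : pol d f -> pol (S d) (fun z => z * f z).
Proof. intros H. exists 0, f. split; [exact H | intros; ring]. Qed.

Lemma pol_S (d : nat) (f : R -> R) : pol d f -> pol (S d) f.
Proof.
  revert f; induction d as [|d IH]; intros f.
  - intros [c H]. exists c, (fun _ => 0). split; [apply (pol_const 0) | intros; rewrite H; ring].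
  - intros [c [g [Hg E]]]. exists c, g. split; [apply IH; exact Hg | exact E].
Qed.

Lemma pol_le (d e : nat) (f : R -> R) : (d <= e)%nat -> pol d f -> pol e f.
Proof. induction 1; auto using pol_S. Qed.

Lemma pol_mult (d e : nat) (f g : R -> R) :
  pol d f -> pol e g -> pol (d + e) (fun z => f z * g z).
Proof.
  revert f; induction d as [|d IH]; intros f.
  - intros [c Hc] Hg. apply (pol_ext _ (fun z => c * g z)); [intros; rewrite Hc; reflexivity|].
    apply pol_scal; exact Hg.
  - intros [c [f' [Hf E]]] Hg.
    apply (pol_ext _ (fun z => c * g z + z * (f' z * g z))); [intros; rewrite E; ring|].
    apply pol_plus.
    + apply (pol_le e); [lia|]. apply pol_scal; exact Hg.
    + apply (pol_mulX (d + e)), IH; assumption.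
Qed.

Lemma pol_pow (d n : nat) (f : R -> R) : pol d f -> pol (n * d) (fun z => f z ^ n).
Proof.
  intros H. induction n as [|n IH]; [exists 1; auto|].
  apply (pol_mult d (n * d)); assumption.
Qed.

Lemma pol_affine (c e : R) : pol 1 (fun z => c + e * z).
Proof. exists c, (fun _ => e). split; [apply (pol_const 0) | intros; ring]. Qed.

Lemma pol_reflect (d : nat) (f : R -> R) : pol d f -> pol d (fun z => f (1 - z)).
Proof.
  revert f; induction d as [|d IH]; intros f.
  - intros [c H]. exists c. auto.
  - intros [c [g [Hg E]]].
    apply (pol_ext _ (fun z => c + (1 + -1 * z) * g (1 - z))).
    + intros; rewrite E. f_equal; f_equal; ring.
    + apply pol_plus; [apply pol_const|]. apply (pol_mult 1 d); [apply pol_affine | apply IH, Hg].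
Qed.

Lemma pol_sum (d n : nat) (f : nat -> R -> R) : (forall i, (i <= n)%nat -> pol d (f i)) ->
  pol d (fun z => sum_f_R0 (fun i => f i z) n).
Proof.
  intros H. induction n as [|n IH]; simpl; [apply H; lia|].
  apply pol_plus; [apply IH; intros|]; apply H; lia.
Qed.

Lemma pol_poly_eval (c : nat -> R) (d : nat) : pol d (poly_eval c d).
Proof.
  unfold poly_eval. apply pol_sum. intros i Hi. apply pol_scal.
  apply (pol_le (i * 1)); [lia|]. apply (pol_pow 1 i (fun z => z)).
  apply (pol_ext _ (fun z => 0 + 1 * z)); [intros; ring | apply pol_affine].
Qed.

(** Returns to coefficient sequences, the form in which competitors enter [is_pade_at1]. *)
Lemma pol_coefs (d : nat) (f : R -> R) : pol d f -> exists c, forall z, f z = poly_eval c d z.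
Proof.
  revert f; induction d as [|d IH]; intros f.
  - intros [c H]. exists (fun _ => c). intros; rewrite H. unfold poly_eval; simpl; ring.
  - intros [e [g [Hg E]]]. destruct (IH g Hg) as [c Hc].
    exists (fun i => match i with O => e | S i => c i end).
    intros z. rewrite E, Hc. unfold poly_eval. rewrite (decomp_sum _ (S d)) by lia.
    simpl pred. rewrite scal_sum. simpl (z ^ 0). f_equal; [ring|].
    apply sum_eq. intros; simpl; ring.
Qed.

Lemma pol_continuity (d : nat) (f : R -> R) : pol d f -> continuity f.
Proof.
  intros H. destruct (pol_coefs d f H) as [c Hc]. intros x.
  apply (continuity_pt_ext (poly_eval c d)); [intros; auto|].
  unfold poly_eval. apply continuity_pt_finite_SF. intros k _.
  apply derivable_continuous_pt. apply ex_derive_Reals_0. auto_derive. exact I.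
Qed.

(** * Orders of vanishing at 0 *)

(* [f z = O(z^d)] as [z -> 0], with [z = 0] excluded. *)
Definition flat (d : nat) (f : R -> R) : Prop :=
  exists C delta, 0 < delta /\ forall z, 0 < Rabs z < delta -> Rabs (f z) <= C * Rabs z ^ d.

Lemma flat_ext_near (d : nat) (f g : R -> R) (r : R) : 0 < r ->
  (forall z, 0 < Rabs z < r -> f z = g z) -> flat d f -> flat d g.
Proof.
  intros Hr E [C [delta [Hd H]]]. exists C, (Rmin r delta). split; [apply Rmin_pos; assumption|].
  intros z Hz. pose proof (Rmin_l r delta). pose proof (Rmin_r r delta).
  rewrite <- E by lra. apply H; lra.
Qed.

Lemma flat_plus (d : nat) (f g : R -> R) : flat d f -> flat d g -> flat d (fun z => f z + g z).
Proof.
  intros [C [r [Hr H]]] [C' [r' [Hr' H']]]. exists (C + C'), (Rmin r r').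
  split; [apply Rmin_pos; assumption|]. intros z Hz.
  pose proof (Rmin_l r r'). pose proof (Rmin_r r r').
  eapply Rle_trans; [apply Rabs_triang|]. rewrite Rmult_plus_distr_r.
  apply Rplus_le_compat; [apply H | apply H']; lra.
Qed.

Lemma flat_mult (d e : nat) (f g : R -> R) :
  flat d f -> flat e g -> flat (d + e) (fun z => f z * g z).
Proof.
  intros [C [r [Hr H]]] [C' [r' [Hr' H']]]. exists (C * C'), (Rmin r r').
  split; [apply Rmin_pos; assumption|]. intros z Hz.
  pose proof (Rmin_l r r'). pose proof (Rmin_r r r').
  rewrite Rabs_mult, pow_add.
  replace (C * C' * (Rabs z ^ d * Rabs z ^ e)) with (C * Rabs z ^ d * (C' * Rabs z ^ e)) by ring.
  apply Rmult_le_compat; try apply Rabs_pos; [apply H | apply H']; lra.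
Qed.

Lemma flat_le (d e : nat) (f : R -> R) : (e <= d)%nat -> flat d f -> flat e f.
Proof.
  (* For [|z| <= 1] the smaller exponent gives the larger power; the constant must be nonnegative
     for this to enlarge the bound. *)
  intros He [C [r [Hr H]]]. exists (Rmax C 0), (Rmin r 1).
  split; [apply Rmin_pos; lra|]. intros z Hz.
  pose proof (Rmin_l r 1). pose proof (Rmin_r r 1).
  eapply Rle_trans; [apply H; lra|].
  assert (0 < Rabs z ^ d) by (apply pow_lt; lra).
  assert (Rabs z ^ d <= Rabs z ^ e).
  { replace d with (e + (d - e))%nat by lia. rewrite pow_add.
    assert (0 < Rabs z ^ e) by (apply pow_lt; lra).
    assert (Rabs z ^ (d - e) <= 1) by (rewrite <- (pow1 (d - e)); apply pow_incr; lra).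
    nra. }
  pose proof (Rmax_l C 0). pose proof (Rmax_r C 0). nra.
Qed.

Lemma flat_continuity (f : R -> R) : continuity_pt f 0 -> flat 0 f.
Proof.
  intros H. destruct (H 1 Rlt_0_1) as [r [Hr Hf]].
  exists (Rabs (f 0) + 1), r. split; [exact Hr|]. intros z Hz.
  assert (Hz0 : z <> 0) by (intros ->; rewrite Rabs_R0 in Hz; lra).
  assert (E : Rabs (f z - f 0) < 1).
  { apply Hf. split; [split; [exact I | auto]|]. simpl. unfold Rdist. rewrite Rminus_0_r. lra. }
  simpl. rewrite Rmult_1_r.
  replace (f z) with (f 0 + (f z - f 0)) by ring.
  eapply Rle_trans; [apply Rabs_triang|]. lra.
Qed.

Lemma flat_pol (d : nat) (f : R -> R) : pol d f -> flat 0 f.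
Proof. intros H. apply flat_continuity, (pol_continuity d f H). Qed.

Lemma flat_scal (d : nat) (c : R) (f : R -> R) : flat d f -> flat d (fun z => c * f z).
Proof. intros H. apply (flat_mult 0 d (fun _ => c) f); [apply (flat_pol 0), pol_const | exact H].
    Qed.

Lemma flat_minus (d : nat) (f g : R -> R) : flat d f -> flat d g -> flat d (fun z => f z - g z).
Proof.
  intros Hf Hg. apply (flat_ext_near _ (fun z => f z + -1 * g z) _ 1); [lra | intros; ring |].
  apply flat_plus, flat_scal; assumption.
Qed.

Lemma flat_pow (d : nat) : flat d (fun z => z ^ d).
Proof. exists 1, 1. split; [lra|]. intros z _. rewrite RPow_abs. lra. Qed.

Lemma le_mul_small_eq_0 (c C r : R) : 0 < r ->
  (forall z, 0 < z < r -> Rabs c <= C * z) -> c = 0.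
Proof.
  intros Hr H. destruct (Req_dec c 0) as [E|E]; [exact E|exfalso].
  apply Rabs_pos_lt in E.
  (* Chosen so that [(|C| + 1) z <= |c| / 2], which contradicts [|c| <= C z]. *)
  set (z := Rmin (r / 2) (Rabs c / (2 * (Rabs C + 1)))).
  pose proof (Rabs_pos C). pose proof (Rle_abs C).
  assert (0 < Rabs c / (2 * (Rabs C + 1))) by (apply Rdiv_lt_0_compat; lra).
  assert (Hz : 0 < z) by (apply Rmin_pos; lra).
  assert (z <= r / 2) by apply Rmin_l.
  assert (Hz2 : z <= Rabs c / (2 * (Rabs C + 1))) by apply Rmin_r.
  specialize (H z ltac:(lra)).
  assert (z * (2 * (Rabs C + 1)) <= Rabs c).
  { apply (Rmult_le_compat_r (2 * (Rabs C + 1))) in Hz2; [|lra].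
    replace (Rabs c / (2 * (Rabs C + 1)) * (2 * (Rabs C + 1))) with (Rabs c) in Hz2 by (field; lra).
    exact Hz2. }
  nra.
Qed.

(** Turns a local estimate into a global identity. In [f z = c + z * g z] flatness forces [c = 0],
    and division by [z], legitimate because [flat] excludes 0, leaves [g] flat of one order less. *)
Lemma pol_flat_monomial (d : nat) (f : R -> R) :
  pol d f -> flat d f -> exists c, forall z, f z = c * z ^ d.
Proof.
  revert f; induction d as [|d IH]; intros f.
  - intros [c H] _. exists c. intros; rewrite H; simpl; ring.
  - intros [c [g [Hg E]]] Hf.
    assert (c = 0) as ->.
    { assert (H1 : flat 1 (fun z => c * 1)).
      { apply (flat_ext_near _ (fun z => f z - z ^ 1 * g z) _ 1);
          [lra | intros; rewrite E; ring |].
        apply flat_minus; [apply (flat_le (S d)); [lia | exact Hf]|].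
        apply (flat_mult 1 0); [apply flat_pow | apply (flat_pol d), Hg]. }
      destruct H1 as [C [r [Hr H1]]]. apply (le_mul_small_eq_0 c C r Hr).
      intros z Hz. specialize (H1 z). rewrite (Rabs_right z) in H1 by lra.
      rewrite Rmult_1_r, pow_1 in H1. apply H1; lra. }
    destruct (IH g Hg) as [e He].
    + destruct Hf as [C [r [Hr H]]]. exists C, r. split; [exact Hr|]. intros z Hz.
      specialize (H z Hz). rewrite E, Rplus_0_l, Rabs_mult in H. simpl in H.
      apply (Rmult_le_reg_l (Rabs z)); lra.
    + exists e. intros z. rewrite E, He. simpl; ring.
Qed.

Lemma pol_flat_zero (d : nat) (f : R -> R) :
  pol d f -> flat (S d) f -> forall z, f z = 0.
Proof.
  intros Hp Hf. destruct (pol_flat_monomial d f Hp) as [c Hc];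
    [apply (flat_le (S d)); [lia | exact Hf]|].
  assert (c = 0) as ->; [|intros; rewrite Hc; ring].
  destruct Hf as [C [r [Hr H]]]. apply (le_mul_small_eq_0 c C r Hr).
  intros z Hz. assert (Hz' : 0 < Rabs z < r) by (rewrite Rabs_right; lra).
  specialize (H z Hz'). rewrite Hc, Rabs_mult, <- RPow_abs in H. simpl in H.
  rewrite (Rabs_right z) in H by lra.
  assert (0 < z ^ d) by (apply pow_lt; lra).
  apply (Rmult_le_reg_r (z ^ d)); [assumption|]. lra.
Qed.

(** * Degrees and order of contact of the explicit approximant *)

Lemma pol_den (a b : R) (k : nat) : pol k (fun z => pade_den a b k (1 - z)).
Proof.
  apply (pol_reflect k (pade_den a b k)).
  apply (pol_ext _ (poly_eval (fun j => Binomial.C k j / (poch a (k - j) * poch b j)) k));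
    [|apply pol_poly_eval].
  intros z. unfold poly_eval, pade_den. apply sum_eq. intros; unfold Rdiv; ring.
Qed.

Lemma pol_psum (u : nat -> R) (n : nat) : pol n (psum u (S n)).
Proof.
  induction n as [|n IH].
  - exists (u 0%nat). intros; simpl; ring.
  - change (pol (S n) (fun z => psum u (S n) z + u (S n) * z ^ S n)).
    apply pol_plus; [apply pol_S, IH|]. apply pol_scal.
    apply (pol_le (S n * 1)); [lia|]. apply (pol_pow 1 (S n) (fun z => z)).
    apply (pol_ext _ (fun z => 0 + 1 * z)); [intros; ring | apply pol_affine].
Qed.

Lemma continuity_Rpower_1_minus (b z : R) : z < 1 ->
  continuity_pt (fun z => Rpower (1 - z) b) z.
Proof.
  intros Hz. apply derivable_continuous_pt, ex_derive_Reals_0.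
  unfold Rpower. auto_derive. lra.
Qed.

Lemma continuity_tail (al : R) (k : nat) (z : R) : 0 < al < 1 -> Rabs z < 1 ->
  continuity_pt (tail_PSeries al k) z.
Proof.
  intros Hal Hz. apply PSeries_continuity. rewrite CV_radius_tail by assumption. exact Hz.
Qed.

Lemma flat_pade_error (al : R) (k : nat) : 0 < al < 1 ->
  flat (2 * k) (fun z => pade_den al (1 - al) k (1 - z) * Rpower (1 - z) (- al) - pade_num al k z).
Proof.
  intros Hal. apply (flat_ext_near _ (fun z => z ^ (2 * k) * (lead_const k
      * tail_PSeries al k z)) _ 1).
  - lra.
  - intros z Hz. rewrite pade_error by (assumption || lra). ring.
  - replace (2 * k)%nat with (2 * k + 0)%nat at 1 by lia.
    apply flat_mult; [apply flat_pow|]. apply flat_scal, flat_continuity, continuity_tail;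
      [assumption | rewrite Rabs_R0; lra].
Qed.

Lemma tail_PSeries_0 (al : R) (k : nat) : tail_PSeries al k 0 = 1.
Proof. unfold tail_PSeries. rewrite PSeries_0. unfold hyp_coef. simpl. field. Qed.

Lemma lead_pos (k : nat) : 0 < lead_const k.
Proof. apply Rdiv_lt_0_compat; apply INR_fact_lt_0. Qed.

Lemma pol_mult_num (al : R) (k : nat) (q : R -> R) :
  pol (S k) q -> pol (2 * k) (fun z => q z * pade_num al k z).
Proof.
  intros Hq. destruct k as [|n].
  - exists 0. intros; unfold pade_num; simpl; ring.
  - replace (2 * S n)%nat with (S (S n) + n)%nat by lia.
    apply pol_mult; [exact Hq | apply pol_psum].
Qed.

(** Eliminating the power [(1 - z)^(-al)] from the two error functions writes the cross difference
    as a combination of them, hence as [O(z^(2k))]; its degree is at most [2k]. *)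
Lemma cross_monomial (al : R) (k : nat) (p q : R -> R) : 0 < al < 1 ->
  pol (S k) q -> pol k p ->
  flat (2 * S k) (fun z => q z * Rpower (1 - z) (- al) - p z) ->
  exists d, forall z, q z * pade_num al k z - p z * pade_den al (1 - al) k (1 - z)
    = d * z ^ (2 * k).
Proof.
  intros Hal Hq Hp Hf. apply pol_flat_monomial.
  - apply pol_minus; [apply pol_mult_num; exact Hq|].
    replace (2 * k)%nat with (k + k)%nat by lia.
    apply pol_mult; [exact Hp | apply pol_den].
  - apply (flat_ext_near _ (fun z => (q z * Rpower (1 - z) (- al) - p z) *
      pade_den al (1 - al) k (1 - z) - (pade_den al (1 - al) k (1 - z) * Rpower (1 - z) (- al)
      - pade_num al k z) * q z) _ 1);
      [lra | intros; ring |].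
    replace (2 * k)%nat with (2 * k + 0)%nat by lia.
    apply flat_minus; apply flat_mult.
    + apply (flat_le (2 * S k)); [lia | exact Hf].
    + apply (flat_pol k), pol_den.
    + apply flat_pade_error; exact Hal.
    + apply (flat_pol (S k)), Hq.
Qed.

(* The cross difference of two consecutive approximants sees only the leading error
   coefficient of the lower one. *)
Lemma wronskian_monomial (al : R) (k : nat) : 0 < al < 1 -> exists c, c <> 0 /\
  forall z, pade_den al (1 - al) (S k) (1 - z) * pade_num al k z - pade_num al (S k) z
      * pade_den al (1 - al) k (1 - z) = c * z ^ (2 * k).
Proof.
  intros Hal.
  destruct (cross_monomial al k (pade_num al (S k)) (fun z => pade_den al (1 - al) (S k) (1 - z))) as [c Hc].
  - exact Hal.
  - apply pol_den.
  - apply pol_psum.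
  - apply flat_pade_error; exact Hal.
  - exists c. split; [|exact Hc]. intros ->.
    (* Up to sign, [G] is the cross difference divided by [z^(2k)]. It is continuous and nonzero at
       0, whereas [c = 0] would make it vanish at small nonzero [z]. *)
    set (G := fun z => lead_const k * tail_PSeries al k z * pade_den al (1 - al) (S k) (1 - z)
                     - z ^ 2 * (lead_const (S k) * tail_PSeries al (S k) z *
      pade_den al (1 - al) k (1 - z))).
    assert (HG0 : G 0 <> 0).
    { unfold G. rewrite tail_PSeries_0.
      pose proof (lead_pos k). pose proof (pade_den_pos al (1 - al) (S k) (1 - 0) ltac:(lra) ltac:(lra) ltac:(lra)).
      simpl pow. rewrite Rmult_0_l, Rmult_0_l, Rminus_0_r, Rmult_1_r.
      apply Rmult_integral_contrapositive_currified; lra. }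
    assert (HG : continuity_pt G 0).
    { assert (T : forall n, continuity_pt (tail_PSeries al n) 0)
        by (intros n; apply continuity_tail; [exact Hal | rewrite Rabs_R0; lra]).
      assert (D : forall n, continuity_pt (fun z => pade_den al (1 - al) n (1 - z)) 0)
        by (intros n; apply (pol_continuity n); apply pol_den).
      unfold G. apply continuity_pt_minus; apply continuity_pt_mult.
      - apply continuity_pt_scal, T.
      - apply D.
      - apply derivable_continuous_pt, derivable_pt_pow.
      - apply continuity_pt_mult; [apply continuity_pt_scal, T | apply D]. }
    destruct (continuous_neq_0 G 0 HG HG0) as [eps Heps].
    set (z := Rmin (eps / 2) (/ 2)).
    assert (0 < z) by (apply Rmin_pos; [pose proof (cond_pos eps)|]; lra).
    assert (z <= eps / 2) by apply Rmin_l. assert (z <= / 2) by apply Rmin_r.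
    assert (Hz : Rabs z < 1) by (rewrite Rabs_right; lra).
    apply (Heps z); [rewrite Rabs_right; lra|]. rewrite Rplus_0_l.
    specialize (Hc z).
    pose proof (pade_error al k z Hal Hz) as E1. pose proof (pade_error al (S k) z Hal Hz) as E2.
    assert (N1 : pade_num al k z = pade_den al (1 - al) k (1 - z) * Rpower (1 - z) (- al)
        - lead_const k * z ^ (2 * k) * tail_PSeries al k z) by lra.
    assert (N2 : pade_num al (S k) z = pade_den al (1 - al) (S k) (1 - z) * Rpower (1 - z) (- al)
        - lead_const (S k) * z ^ (2 * S k) * tail_PSeries al (S k) z)
      by lra.
    rewrite N1, N2 in Hc.
    replace (2 * S k)%nat with (2 * k + 2)%nat in Hc by lia. rewrite pow_add in Hc.
    assert (0 < z ^ (2 * k)) by (apply pow_lt; assumption).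
    apply (Rmult_eq_reg_r (z ^ (2 * k))); [|lra]. unfold G. lra.
Qed.

Lemma pade_unique (al : R) (k : nat) (p q : R -> R) : 0 < al < 1 ->
  pol (S k) q -> pol k p -> q 0 <> 0 ->
  flat (2 * S k) (fun z => q z * Rpower (1 - z) (- al) - p z) ->
  exists c d, c <> 0 /\ d <> 0 /\ forall z, z <> 0 ->
    c * q z = d * pade_den al (1 - al) (S k) (1 - z) /\ c * p z = d * pade_num al (S k) z.
Proof.
  intros Hal Hq Hp Hq0 Hf.
  destruct (wronskian_monomial al k Hal) as [c [Hc W]].
  destruct (cross_monomial al k p q Hal Hq Hp Hf) as [d D].
  (* Two pairs with the same order of contact are proportional: this cross difference has degree at
     most [2k+1] but vanishes to order [2k+2]. *)
  assert (E0 : forall z, q z * pade_num al (S k) z - p z * pade_den al (1 - al) (S k) (1 - z) = 0).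
  { apply (pol_flat_zero (S k + k)).
    - apply pol_minus; [apply pol_mult; [exact Hq | apply pol_psum]|].
      rewrite Nat.add_comm. apply pol_mult; [exact Hp | apply pol_den].
    - apply (flat_ext_near _ (fun z => (q z * Rpower (1 - z) (- al) - p z) *
      pade_den al (1 - al) (S k) (1 - z) - (pade_den al (1 - al) (S k) (1 - z) * Rpower (1 - z) (- al)
        - pade_num al (S k) z) * q z) _ 1);
        [lra | intros; ring |].
      replace (S (S k + k)) with (2 * S k + 0)%nat by lia.
      apply flat_minus; apply flat_mult.
      + exact Hf.
      + apply (flat_pol (S k)), pol_den.
      + apply flat_pade_error; exact Hal.
      + apply (flat_pol (S k)), Hq. }
  (* Multiplied by [z^(2k)], both sides become cross products through [W] and [D]; their difference
     is a multiple of the expression in [E0]. *)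
  assert (E : forall z, z <> 0 -> c * q z = d * pade_den al (1 - al) (S k) (1 - z) /\ c * p z = d
      * pade_num al (S k) z).
  { intros z Hz. specialize (W z). specialize (D z). specialize (E0 z).
    assert (z ^ (2 * k) <> 0) by (apply pow_nonzero; exact Hz).
    split; apply (Rmult_eq_reg_r (z ^ (2 * k))); try assumption.
    - replace (c * q z * z ^ (2 * k)) with (c * z ^ (2 * k) * q z) by ring.
      replace (d * pade_den al (1 - al) (S k) (1 - z) * z ^ (2 * k)) with (d * z ^ (2 * k)
          * pade_den al (1 - al) (S k) (1 - z)) by ring.
      rewrite <- W, <- D.
      assert (pade_den al (1 - al) k (1 - z) * (q z * pade_num al (S k) z - p z *
      pade_den al (1 - al) (S k) (1 - z)) = 0) by (rewrite E0; ring). lra.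
    - replace (c * p z * z ^ (2 * k)) with (c * z ^ (2 * k) * p z) by ring.
      replace (d * pade_num al (S k) z * z ^ (2 * k)) with (d * z ^ (2 * k)
          * pade_num al (S k) z) by ring.
      rewrite <- W, <- D.
      assert (pade_num al k z * (q z * pade_num al (S k) z - p z * pade_den al (1 - al) (S k) (1 - z)) = 0) by (rewrite E0; ring). lra. }
  exists c, d. split; [exact Hc|]. split; [|exact E].
  (* With [d = 0] the polynomial [q] would vanish away from 0, hence everywhere, against
     [q 0 <> 0]. *)
  intros ->. apply Hq0. apply (pol_flat_zero (S k) q Hq).
  apply (flat_ext_near _ (fun z => z ^ S (S k) * 0) _ 1); [lra | |].
  - intros z Hz. assert (Hz0 : z <> 0) by (intros ->; rewrite Rabs_R0 in Hz; lra).
    destruct (E z Hz0) as [E1 _]. rewrite Rmult_0_l in E1.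
    destruct (Rmult_integral _ _ E1); [contradiction | lra].
  - replace (S (S k)) with (S (S k) + 0)%nat at 1 by lia.
    apply flat_mult; [apply flat_pow | apply (flat_pol 0), (pol_const 0)].
Qed.

(** * Continuation to the half-line and the error formula *)

Lemma hyp_series_unique (a b c z l : R) :
  infinite_sum (hyp_term a b c z) l -> hyp_series a b c z = l.
Proof.
  intros H. unfold hyp_series. eapply uniqueness_sum; [|exact H].
  apply epsilon_spec. exists l; exact H.
Qed.

Lemma hyp2f1_unique (a b c z l : R) :
  infinite_sum (hyp_term a b c z) l -> hyp2f1 a b c z = l.
Proof.
  intros H. unfold hyp2f1. destruct excluded_middle_informative as [_|N].
  - apply hyp_series_unique, H.
  - contradict N. exists l; exact H.
Qed.

Lemma ex_pseries_hyp_sum (a b c z : R) : ex_pseries (hyp_coef a b c) z ->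
  infinite_sum (hyp_term a b c z) (PSeries (hyp_coef a b c) z).
Proof. intros H. apply is_series_Reals, is_pseries_R, PSeries_correct, H. Qed.

Lemma finite_infinite_sum (f : nat -> R) (k : nat) :
  (forall i, (k < i)%nat -> f i = 0) -> infinite_sum f (sum_f_R0 f k).
Proof.
  intros H eps Heps. exists k. intros n Hn.
  replace (sum_f_R0 f n) with (sum_f_R0 f k); [rewrite Rdist_eq; exact Heps|].
  induction Hn as [|n Hn IH]; [reflexivity|].
  simpl. rewrite H by lia. rewrite <- IH. ring.
Qed.

(** The factor [poch (-k) i] vanishes for [i > k], so the series terminates and [hyp2f1] is its sum
    even when [|1/z| >= 1]. Multiplication by [(-z)^k] reverses the polynomial into the expansion of
    [pade_den_monomials]. *)
Lemma hyp2f1_reciprocal_den (al : R) (k : nat) (z : R) : 0 < al < 1 -> z <> 0 ->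
  (- z) ^ k * hyp2f1 (- INR k) (INR k) al (/ z) = poch (1 - al) k * pade_den al (1 - al) k (1 - z).
Proof.
  intros Hal Hz.
  rewrite (hyp2f1_unique _ _ _ _ (sum_f_R0 (hyp_term (- INR k) (INR k) al (/ z)) k)).
  2: { apply finite_infinite_sum. intros i Hi. unfold hyp_term.
       rewrite poch_opp_INR_gt by exact Hi. unfold Rdiv. ring. }
  rewrite pade_den_monomials by lra. symmetry. rewrite <- sum_rev. symmetry. rewrite !scal_sum.
  apply sum_eq. intros i Hi. unfold hyp_term.
  rewrite poch_opp_INR, <- (pascal_step1 k i) by exact Hi.
  replace (k - (k - i))%nat with i by lia.
  replace (al + (1 - al) + INR k - 1) with (INR k) by ring.
  replace ((- z) ^ k) with ((- z) ^ (k - i) * (- z) ^ i) by (rewrite <- pow_add; f_equal; lia).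
  pose proof (poch_pos al i ltac:(lra)). pose proof (poch_pos (1 - al) k ltac:(lra)).
  pose proof (INR_fact_lt_0 i).
  assert (E : (- z) ^ i * (/ z) ^ i * (-1) ^ i = 1).
  { rewrite <- !Rpow_mult_distr. replace (- z * / z * -1) with 1 by (field; exact Hz). apply pow1. }
  transitivity ((- z) ^ i * (/ z) ^ i * (-1) ^ i * (Binomial.C k i * poch (INR k) i / poch al i
      * (- z) ^ (k - i)));
    [field; split; lra | rewrite E; field; split; lra].
Qed.

(** The factor [(1 - z)^n] clears the denominators, because [(1 - z) * (z / (z - 1)) = - z]. *)
Lemma psum_homogenized (u : nat -> R) (n : nat) : exists g, pol n g /\
  forall z, z <> 1 -> (1 - z) ^ n * psum u (S n) (z / (z - 1)) = g z.
Proof.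
  induction n as [|n [g [Hg E]]].
  - exists (fun _ => u 0%nat). split; [apply pol_const | intros; simpl; ring].
  - exists (fun z => (1 + -1 * z) * g z + u (S n) * (0 + -1 * z) ^ S n). split.
    + apply pol_plus; [apply (pol_mult 1 n); [apply pol_affine | exact Hg]|].
      apply pol_scal, (pol_le (S n * 1)); [lia|]. apply (pol_pow 1 (S n)), pol_affine.
    + intros z Hz.
      change (psum u (S (S n)) (z / (z - 1)))
        with (psum u (S n) (z / (z - 1)) + u (S n) * (z / (z - 1)) ^ S n).
      rewrite Rmult_plus_distr_l, <- E by exact Hz. f_equal; [simpl; ring|].
      transitivity (u (S n) * ((1 - z) ^ S n * (z / (z - 1)) ^ S n)); [ring|].
      rewrite <- Rpow_mult_distr. do 2 f_equal. field. lra.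
Qed.

Lemma Rpower_inv_base (x y : R) : 0 < x -> Rpower (/ x) y = Rpower x (- y).
Proof. intros Hx. unfold Rpower. rewrite ln_Rinv by exact Hx. f_equal. ring. Qed.

(* This is the identity for [1 - al] at [w = z/(z-1)]: as [1 - w = 1/(1-z)], reversing the
   denominator turns it into an identity for [al] at [z]. *)
Lemma pade_error_pfaff_aux (al : R) (n : nat) (z : R) : 0 < al < 1 -> z < / 2 ->
  pade_den al (1 - al) (S n) (1 - z) * Rpower (1 - z) (- al)
  = (1 - z) ^ n * pade_num (1 - al) (S n) (z / (z - 1))
    + lead_const (S n) * z ^ (2 * S n) *
      (Rpower (1 - z) (- (INR (S n) + 1)) * tail_PSeries (1 - al) (S n) (z / (z - 1))).
Proof.
  intros Hal Hz. set (w := z / (z - 1)).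
  (* The condition [z < 1/2] amounts to [|z| < 1 - z]. *)
  assert (Hw : Rabs w < 1).
  { unfold w. apply Rabs_def1.
    - apply (Rmult_lt_reg_r (1 - z)); [lra|]. replace (z / (z - 1) * (1 - z)) with (- z) by (field; lra). lra.
    - apply (Rmult_lt_reg_r (1 - z)); [lra|]. replace (z / (z - 1) * (1 - z)) with (- z) by (field; lra). lra. }
  assert (Ew : 1 - w = / (1 - z)) by (unfold w; field; lra).
  pose proof (pade_error (1 - al) (S n) w ltac:(lra) Hw) as E.
  rewrite Ew in E. replace (1 - (1 - al)) with al in E by ring.
  rewrite pade_den_rev by lra.
  rewrite Rpower_inv_base in E by lra.
  replace (- - (1 - al)) with (1 + - al) in E by ring.
  rewrite Rpower_plus, Rpower_1 in E by lra.
  (* Of the [n + 1] factors [1 - z] produced by the reversal, one joins [(1 - z)^(-al)] to form the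
     power in [E]. In the error term the exponents of [1 - z] then add up to [n - (2n + 2)]. *)
  transitivity ((1 - z) ^ n * (pade_den (1 - al) al (S n) (/ (1 - z)) * ((1 - z) * Rpower (1 - z) (- al))));
    [simpl; ring|].
  rewrite E, Rmult_plus_distr_l. f_equal.
  replace (Rpower (1 - z) (- (INR (S n) + 1))) with (/ (1 - z) ^ S (S n))
    by (rewrite Rpower_Ropp, <- S_INR, Rpower_pow by lra; reflexivity).
  replace (w ^ (2 * S n)) with (z ^ (2 * S n) / (1 - z) ^ (2 * S n)).
  - replace (2 * S n)%nat with (n + S (S n))%nat by lia. rewrite !pow_add.
    field. split; apply pow_nonzero; lra.
  - replace w with (- z * / (1 - z)) by (unfold w; field; lra).
    rewrite Rpow_mult_distr, pow_inv. unfold Rdiv. f_equal.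
    rewrite !pow_mult. f_equal. ring.
Qed.

(** Both sides approximate the same function up to [O(z^(2n+2))] by polynomials of degree at most
    [n], so they coincide. *)
Lemma pade_num_pfaff (al : R) (n : nat) (z : R) : 0 < al < 1 -> z < 1 ->
  (1 - z) ^ n * pade_num (1 - al) (S n) (z / (z - 1)) = pade_num al (S n) z.
Proof.
  intros Hal Hz.
  destruct (psum_homogenized (pade_coef (1 - al) (S n)) n) as [g [Hg E]].
  unfold pade_num at 1. rewrite E by lra.
  enough (H : forall z, g z - pade_num al (S n) z = 0) by (specialize (H z); lra).
  apply (pol_flat_zero n).
  { apply pol_minus; [exact Hg | apply pol_psum]. }
  apply (flat_le (2 * S n)); [lia|].
  set (F := fun z => lead_const (S n) * (Rpower (1 - z) (- (INR (S n) + 1)) * tail_PSeries (1 - al) (S n) (z / (z - 1)))).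
  apply (flat_ext_near _ (fun z => pade_den al (1 - al) (S n) (1 - z) * Rpower (1 - z) (- al)
    - pade_num al (S n) z - z ^ (2 * S n) * F z) _ (/ 2)); [lra | |].
  - intros t Ht. assert (t < / 2) by (pose proof (Rle_abs t); lra).
    rewrite pade_error_pfaff_aux by assumption.
    unfold F. rewrite <- E by lra. unfold pade_num. ring.
  - apply flat_minus; [apply flat_pade_error; exact Hal|].
    replace (2 * S n)%nat with (2 * S n + 0)%nat at 1 by lia.
    apply flat_mult; [apply flat_pow|]. apply flat_continuity. unfold F.
    apply continuity_pt_scal, continuity_pt_mult; [apply continuity_Rpower_1_minus; lra|].
    apply (continuity_pt_comp (fun z => z / (z - 1))).
    + apply derivable_continuous_pt, ex_derive_Reals_0. auto_derive. lra.
    + apply continuity_tail; [lra|]. replace (0 / (0 - 1)) with 0 by field. rewrite Rabs_R0; lra.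
Qed.

Lemma pade_error_pfaff (al : R) (n : nat) (z : R) : 0 < al < 1 -> z < / 2 ->
  pade_den al (1 - al) (S n) (1 - z) * Rpower (1 - z) (- al)
  = pade_num al (S n) z + lead_const (S n) * z ^ (2 * S n) *
      (Rpower (1 - z) (- (INR (S n) + 1)) * tail_PSeries (1 - al) (S n) (z / (z - 1))).
Proof.
  intros Hal Hz. rewrite pade_error_pfaff_aux, pade_num_pfaff by (assumption || lra). reflexivity.
Qed.

(** Moves the boundary point -1 to 1, where Abel's theorem applies. *)
Lemma CV_radius_alternate (a : nat -> R) : CV_radius (fun n => a n * (-1) ^ n) = CV_radius a.
Proof.
  unfold CV_radius. apply Lub_Rbar_eqset. intros r. unfold CV_disk.
  assert (E : forall n, Rabs (a n * (-1) ^ n * r ^ n) = Rabs (a n * r ^ n))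
    by (intros n; rewrite !Rabs_mult, pow_1_abs; ring).
  split; apply ex_series_ext; auto.
Qed.

Lemma pade_error_at_m1 (al : R) (k : nat) : 0 < al < 1 ->
  ex_pseries (hyp_coef (INR k + 1) (INR k + al) (2 * INR k + 1)) (-1) ->
  pade_den al (1 - al) k (1 - -1) * Rpower (1 - -1) (- al)
  = pade_num al k (-1) + lead_const k * (-1) ^ (2 * k) * tail_PSeries al k (-1).
Proof.
  intros Hal Hex.
  set (h := hyp_coef (INR k + 1) (INR k + al) (2 * INR k + 1)).
  set (a := fun n => h n * (-1) ^ n).
  assert (Ha : CV_radius a = 1) by (unfold a; rewrite CV_radius_alternate; apply CV_radius_tail;
      exact Hal).
  assert (Et : forall t, PSeries a t = tail_PSeries al k (- t)).
  { intros t. unfold PSeries, tail_PSeries, PSeries. apply Series_ext. intros n.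
    unfold a. replace (- t) with (-1 * t) by ring. rewrite Rpow_mult_distr. unfold h. ring. }
  assert (HA : filterlim (PSeries a) (at_left 1) (locally (PSeries a 1))).
  { pose proof (Abel a) as H. rewrite Ha in H. apply H; [simpl; lra | exact I |].
    apply ex_pseries_R. apply ex_pseries_R in Hex. revert Hex. apply ex_series_ext.
    intros n. unfold a, h. simpl. rewrite pow1. ring. }
  (* The points [- t n] lie in the open disc, where the identity is known, and tend to -1. Abel's
     theorem gives the limit of the series, continuity that of everything else. *)
  set (t := fun n => 1 - / (INR n + 2)).
  assert (Hi : forall n, 0 < / (INR n + 2) < 1).
  { intros n. pose proof (pos_INR n). split; [apply Rinv_0_lt_compat; lra|].
    rewrite <- Rinv_1. apply Rinv_lt_contravar; lra. }
  assert (Ht : is_lim_seq t 1).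
  { replace (Finite 1) with (Finite (1 - 0)) by (f_equal; ring).
    apply is_lim_seq_minus'; [apply is_lim_seq_const|].
    replace (Finite 0) with (Rbar_inv p_infty) by reflexivity.
    apply is_lim_seq_inv; [|discriminate].
    eapply is_lim_seq_plus; [apply is_lim_seq_INR | apply is_lim_seq_const | reflexivity]. }
  assert (L1 : is_lim_seq (fun n => PSeries a (t n)) (PSeries a 1)).
  { unfold is_lim_seq. simpl. eapply filterlim_comp; [|exact HA].
    intros U [eps HU]. destruct (Ht (fun y => ball 1 eps y)) as [N HN]; [exists eps; auto|].
    exists N. intros n Hn. apply HU; [apply HN, Hn | unfold t; specialize (Hi n); lra]. }
  set (F := fun z => pade_den al (1 - al) k (1 - z) * Rpower (1 - z) (- al) - pade_num al k z).
  assert (HF : continuity_pt F (-1)).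
  { unfold F. apply continuity_pt_minus; [apply continuity_pt_mult|].
    - apply (pol_continuity k), pol_den.
    - apply continuity_Rpower_1_minus; lra.
    - unfold pade_num. destruct k; [apply (pol_continuity 0 (fun _ => 0)), pol_const|].
      eapply (pol_continuity _ (psum _ _)), pol_psum. }
  assert (Hmt : is_lim_seq (fun n => - t n) (-1)).
  { replace (Finite (-1)) with (Rbar_opp (Finite 1)) by (simpl; f_equal; ring).
    apply -> is_lim_seq_opp. exact Ht. }
  pose proof (is_lim_seq_continuous F _ (-1) HF Hmt) as L2.
  assert (L3 : is_lim_seq (fun n => lead_const k * (- t n) ^ (2 * k) * PSeries a (t n))
     (lead_const k * (-1) ^ (2 * k) * PSeries a 1)).
  { apply is_lim_seq_mult'; [|exact L1].
    apply (is_lim_seq_continuous (fun x => lead_const k * x ^ (2 * k)) _ (-1)); [|exact Hmt].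
    apply continuity_pt_scal, derivable_continuous_pt, derivable_pt_pow. }
  apply (is_lim_seq_ext _ (fun n => F (- t n))) in L3.
  - apply is_lim_seq_unique in L2. apply is_lim_seq_unique in L3. rewrite L3 in L2.
    apply (f_equal real) in L2. cbv beta iota delta [real] in L2. rewrite Et in L2. replace (-
        (1)) with (-1) in L2 by ring. unfold F in L2. lra.
  - intros n. unfold F. rewrite Et, pade_error; [ring | exact Hal |].
    unfold t. specialize (Hi n). apply Rabs_def1; lra.
Qed.

Lemma pade_error_hyp2f1 (al : R) (n : nat) (z : R) : 0 < al < 1 -> z < 1 ->
  pade_den al (1 - al) (S n) (1 - z) * Rpower (1 - z) (- al)
  = pade_num al (S n) z + lead_const (S n) * z ^ (2 * S n) *
      hyp2f1 (INR (S n) + 1) (INR (S n) + al) (2 * INR (S n) + 1) z.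
Proof.
  intros Hal Hz.
  pose proof (CV_radius_tail al (S n) Hal) as HR.
  destruct (Rlt_dec (Rabs z) 1) as [Hz1|Hz1].
  { rewrite (hyp2f1_unique _ _ _ _ (tail_PSeries al (S n) z)).
    - apply pade_error; assumption.
    - apply ex_pseries_hyp_sum, CV_radius_inside. rewrite HR. exact Hz1. }
  assert (Hz' : z <= -1).
  { destruct (Rle_dec z (-1)); [assumption|]. exfalso. apply Hz1, Rabs_def1; lra. }
  unfold hyp2f1. destruct excluded_middle_informative as [[l Hl]|N].
  - assert (Hex : ex_pseries (hyp_coef (INR (S n) + 1) (INR (S n) + al) (2 * INR (S n) + 1)) z)
      by (apply ex_pseries_R; exists l; apply is_series_Reals, Hl).
    destruct (Req_dec z (-1)) as [->|Hz2].
    + rewrite (hyp_series_unique _ _ _ _ (tail_PSeries al (S n) (-1))) by (apply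
        ex_pseries_hyp_sum, Hex).
      apply pade_error_at_m1; assumption.
    (* For [z < -1] the terms do not tend to 0, so the convergent branch is impossible. *)
    + exfalso. apply ex_pseries_R in Hex. apply ex_series_lim_0 in Hex. revert Hex.
      apply CV_disk_outside. rewrite HR. simpl. assert (z < -1) by (destruct Hz'; [assumption |
          contradiction]). rewrite Rabs_left; lra.
  - destruct (Rlt_dec z 1); [|contradiction].
    (* The Pfaff parameter [c - b] is the second parameter of the tail for [1 - al]. *)
    replace (2 * INR (S n) + 1 - (INR (S n) + al)) with (INR (S n) + (1 - al)) by ring.
    rewrite (hyp_series_unique _ _ _ _ (tail_PSeries (1 - al) (S n) (z / (z - 1)))).
    + apply pade_error_pfaff; lra.
    + apply ex_pseries_hyp_sum, CV_radius_inside. rewrite CV_radius_tail by lra.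
      simpl. apply Rabs_def1; apply (Rmult_lt_reg_r (1 - z)); try lra;
      replace (z / (z - 1) * (1 - z)) with (- z) by (field; lra); lra.
Qed.

(** * Identification of every Pade approximant with the explicit one *)

Lemma contact_order_pade_num_den (al : R) (n : nat) : 0 < al < 1 ->
  contact_order (negpow al) (fun x => pade_num al (S n) (1 - x) /
      pade_den al (1 - al) (S n) x) (2 * S n).
Proof.
  intros Hal.
  set (Q := fun z => pade_den al (1 - al) (S n) (1 - z)).
  assert (HQ : forall z, z < 1 -> 0 < Q z) by (intros; apply pade_den_pos; lra).
  assert (Hf : flat (2 * S n) (fun z => (Q z * Rpower (1 - z) (- al) - pade_num al (S n) z) *
      / Q z)).
  { replace (2 * S n)%nat with (2 * S n + 0)%nat at 1 by lia.
    apply flat_mult; [apply flat_pade_error, Hal|]. apply flat_continuity.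
    apply (continuity_pt_inv Q); [apply (pol_continuity (S n)), pol_den|].
    pose proof (HQ 0 Rlt_0_1); lra. }
  destruct Hf as [C [r [Hr H]]]. exists C, (Rmin r 1). split; [apply Rmin_pos; lra|].
  intros x Hx Hx1. pose proof (Rmin_l r 1). pose proof (Rmin_r r 1).
  pose proof (HQ (1 - x) ltac:(lra)) as HQx. specialize (H (1 - x)).
  rewrite (Rabs_minus_sym x) in Hx1 |- *.
  unfold Q in *. replace (1 - (1 - x)) with x in * by ring. unfold negpow.
  replace (Rpower x (- al) - pade_num al (S n) (1 - x) / pade_den al (1 - al) (S n) x)
    with ((pade_den al (1 - al) (S n) x * Rpower x (- al) - pade_num al (S n) (1 - x)) *
        / pade_den al (1 - al) (S n) x) by (field; lra).
  (* [contact_order] includes the centre, which [flat] excludes; there the error is exactly 0. *)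
  destruct (Req_dec x 1) as [->|Hne].
  - pose proof (pade_error al (S n) 0 Hal ltac:(rewrite Rabs_R0; lra)) as E.
    rewrite Rminus_0_r, (pow_i (2 * S n)) in E by lia.
    replace (1 - 1) with 0 by ring. rewrite E, Rabs_R0, (pow_i (2 * S n)) by lia.
    match goal with |- Rabs ?e <= _ => replace e with 0 by ring end. rewrite Rabs_R0. lra.
  - apply H. split; [apply Rabs_pos_lt; lra | lra].
Qed.

(** The explicit quotient is an admissible competitor of contact order [2n+2], so by maximality the
    given approximant has this order too. Multiplied by its denominator, this is the hypothesis of
    [pade_unique]. *)
Lemma is_pade_at1_eq (al : R) (n : nat) (a b : nat -> R) (z : R) : 0 < al < 1 ->
  is_pade_at1 (negpow al) n (S n) a b -> z < 1 -> z <> 0 ->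
  rat_fun n (S n) a b (1 - z) = pade_num al (S n) z / pade_den al (1 - al) (S n) (1 - z).
Proof.
  intros Hal [Hb Hmax] Hz Hz0.
  set (q := fun z => poly_eval b (S n) (1 - z)). set (p := fun z => poly_eval a n (1 - z)).
  assert (Hq : pol (S n) q) by apply pol_reflect, pol_poly_eval.
  assert (Hp : pol n p) by apply pol_reflect, pol_poly_eval.
  assert (Hq0 : q 0 <> 0) by (unfold q; rewrite Rminus_0_r; exact Hb).
  assert (Hc : contact_order (negpow al) (rat_fun n (S n) a b) (2 * S n)).
  { destruct (pol_coefs n (fun x => pade_num al (S n) (1 - x))) as [a' Ea];
      [apply pol_reflect, pol_psum|].
    destruct (pol_coefs (S n) (pade_den al (1 - al) (S n))) as [b' Eb].
    { apply (pol_ext _ (fun x => pade_den al (1 - al) (S n) (1 - (1 - x)))); [intros; f_equal; ring|].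
      apply (pol_reflect _ (fun z => pade_den al (1 - al) (S n) (1 - z))), pol_den. }
    apply (Hmax a' b').
    - rewrite <- Eb. pose proof (pade_den_pos al (1 - al) (S n) 1 ltac:(lra) ltac:(lra)
        ltac:(lra)). lra.
    - destruct (contact_order_pade_num_den al n Hal) as [C [r [Hr H]]].
      exists C, r. split; [exact Hr|]. intros x Hx Hx1. unfold rat_fun.
      rewrite <- Ea, <- Eb. apply H; assumption. }
  assert (Hf : flat (2 * S n) (fun z => q z * Rpower (1 - z) (- al) - p z)).
  { destruct (continuous_neq_0 q 0 (pol_continuity _ _ Hq 0) Hq0) as [eps Heps].
    pose proof (cond_pos eps) as He.
    destruct Hc as [C [r [Hr H]]].
    apply (flat_ext_near _ (fun z => q z * (Rpower (1 - z) (- al) - rat_fun n (S n) a b (1 - z))) _ eps He).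
    - intros t Ht. specialize (Heps t ltac:(lra)). rewrite Rplus_0_l in Heps.
      unfold rat_fun. fold (q t) (p t). field. exact Heps.
    - apply (flat_mult 0 (2 * S n)); [apply (flat_pol (S n)), Hq|].
      exists C, (Rmin r 1). split; [apply Rmin_pos; lra|]. intros t Ht.
      pose proof (Rmin_l r 1). pose proof (Rmin_r r 1). pose proof (Rle_abs t).
      specialize (H (1 - t) ltac:(lra)).
      replace (1 - t - 1) with (- t) in H by ring. rewrite Rabs_Ropp in H. apply H; lra. }
  destruct (pade_unique al n p q Hal Hq Hp Hq0 Hf) as [c [d [Hc0 [Hd0 E]]]].
  destruct (E z Hz0) as [E1 E2].
  pose proof (pade_den_pos al (1 - al) (S n) (1 - z) ltac:(lra) ltac:(lra) ltac:(lra)).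
  unfold rat_fun. fold (q z) (p z).
  replace (q z) with (d * pade_den al (1 - al) (S n) (1 - z)
      / c) by (rewrite <- E1; field; exact Hc0).
  replace (p z) with (d * pade_num al (S n) z / c) by (rewrite <- E2; field; exact Hc0).
  field. repeat split; auto; lra.
Qed.

Theorem theorem1 (alpha : R) (k : nat) (a b : nat -> R) (z : R) :
  0 < alpha < 1 ->
  (1 <= k)%nat ->
  is_pade_at1 (negpow alpha) (k - 1) k a b ->
  z < 1 -> z <> 0 ->
  negpow alpha (1 - z) - rat_fun (k - 1) k a b (1 - z)
  = Gamma (INR k + 1 - alpha) * Gamma (INR k + 1)
      / (Gamma (1 - alpha) * Gamma (2 * INR k + 1))
    * (hyp2f1 (INR k + 1) (INR k + alpha) (2 * INR k + 1) z
       / hyp2f1 (- INR k) (INR k) alpha (/ z))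
    * (- z) ^ k.
Proof.
  intros Hal Hk Hpade Hz Hz0.
  destruct k as [|n]; [lia|].
  replace (S n - 1)%nat with n in * by lia.
  rewrite (is_pade_at1_eq alpha n a b z Hal Hpade Hz Hz0).
  pose proof (pade_error_hyp2f1 alpha n z Hal Hz) as E.
  pose proof (hyp2f1_reciprocal_den alpha (S n) z Hal Hz0) as D.
  pose proof (Gamma_quotient (1 - alpha) (S n) ltac:(lra)) as G.
  pose proof (pade_den_pos alpha (1 - alpha) (S n) (1 - z) ltac:(lra) ltac:(lra) ltac:(lra)) as HQ.
  pose proof (poch_pos (1 - alpha) (S n) ltac:(lra)) as Hpo.
  assert (G2 : Gamma (2 * INR (S n) + 1) = INR (fact (2 * S n))).
  { rewrite <- Gamma_INR_succ, mult_INR. reflexivity. }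
  replace (INR (S n) + (1 - alpha)) with (INR (S n) + 1 - alpha) in G by ring.
  rewrite G2, Gamma_INR_succ.
  set (k := S n) in *.
  set (H := hyp2f1 (INR k + 1) (INR k + alpha) (2 * INR k + 1) z) in *.
  set (K := hyp2f1 (- INR k) (INR k) alpha (/ z)) in *.
  set (Q := pade_den alpha (1 - alpha) k (1 - z)) in *.
  assert (Hzk : (- z) ^ k <> 0) by (apply pow_nonzero; lra).
  (* Dividing by [K] thus supplies the denominator [Q] of the error together with one factor
     [(-z)^k]; the other half of [z^(2k)] is the explicit factor of the formula. *)
  assert (HK : K = poch (1 - alpha) k * Q / (- z) ^ k) by (rewrite <- D; field; exact Hzk).
  unfold negpow.
  replace (Rpower (1 - z) (- alpha)) with ((pade_num alpha k z + lead_const k * z ^ (2 * k) * H)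
      / Q)
    by (rewrite <- E; field; lra).
  assert (Hf : INR (fact (2 * k)) <> 0) by apply INR_fact_neq_0.
  (* The gamma factors amount to [poch (1 - alpha) k * lead_const k], whose rising factorial cancels
     the one in [K]. *)
  replace (Gamma (INR k + 1 - alpha) * INR (fact k) / (Gamma (1 - alpha) * INR (fact (2 * k))))
    with (Gamma (INR k + 1 - alpha) / Gamma (1 - alpha) * lead_const k)
    by (unfold lead_const, Rdiv; rewrite Rinv_mult; ring).
  rewrite G, HK.
  replace (z ^ (2 * k)) with ((- z) ^ k * (- z) ^ k)
    by (rewrite <- Rpow_mult_distr, pow_mult; f_equal; ring).
  field. repeat split; try assumption; lra.
Qed.
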